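(* Let $\{k_n\}_{n\ge1}$ be a sequence of positive integers, $\{\lambda_n\}_{n\ge1}$ and $\{\lambda_n'\}_{n\ge1}$ sequences in $\mathbb{T}$, and $\{\mu_{nk}:n\in\mathbb{N},1\le k\le k_n\}$, $\{\nu_{nk}:n\in\mathbb{N},1\le k\le k_n\}$ two infinitesimal arrays in $\mathcal{M}_{\mathbb{T}}^{\times}$. Define, for every $n$, \[ (\mu_n,\nu_n)=(\delta_{\lambda_n},\delta_{\lambda_n'})\boxtimes(\mu_{n1},\nu_{n1})\boxtimes\cdots\boxtimes(\mu_{nk_n},\nu_{nk_n}),\qquad \rho_n=\delta_{\lambda_n}\uplus\mu_{n1}\uplus\cdots\uplus\mu_{nk_n}, \] and suppose that $\nu_n$ converges weakly to some $\nu\in\mathcal{M}_{\mathbb{T}}$. Let $m$ be the Haar (normalized arc-length) measure on $\mathbb{T}$. Then the following are equivalent: (1) $\mu_n$ converges weakly to $m$. (2) $\rho_n$ converges weakly to $m$.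
   Context: $\mathbb{T}$ is the unit circle, $\mathbb{D}$ the open unit disk, $\mathcal{M}_{\mathbb{T}}$ the set of Borel probability measures on $\mathbb{T}$, $\mathcal{M}_{\mathbb{T}}^{\times}=\{\nu\in\mathcal{M}_{\mathbb{T}}:\int_{\mathbb{T}}\zeta\,d\nu(\zeta)\ne0\}$, and $\delta_\lambda$ is the point mass at $\lambda$. An array $\{\mu_{nk}\}$ is infinitesimal if $\lim_{n\to\infty}\max_{1\le k\le k_n}\mu_{nk}(\{\zeta\in\mathbb{T}:|\zeta-1|\ge\varepsilon\})=0$ for every $\varepsilon>0$. For $\mu\in\mathcal{M}_{\mathbb{T}}$ and $z\in\mathbb{D}$: $m_\mu(z)=\int_{\mathbb{T}}\frac{z\zeta}{1-z\zeta}d\mu(\zeta)$, and $B_\mu(z)=\frac{m_\mu(z)}{z(1+m_\mu(z))}$. The function $B_\mu$ maps $\mathbb{D}$ analytically into $\overline{\mathbb{D}}$, and every analytic map $\mathbb{D}\to\overline{\mathbb{D}}$ equals $B_\mu$ for a unique $\mu\in\mathcal{M}_{\mathbb{T}}$. $F^{\langle-1\rangle}$ denotes the inverse under composition near $0$. For $\mu\in\mathcal{M}_{\mathbb{T}}$, $\nu\in\mathcal{M}_{\mathbb{T}}^\times$, define analytic functions near $0$ by $R_\nu(z[1+m_\nu(z)])=m_\nu(z)$, ${}^cR_{(\mu,\nu)}(z[1+m_\nu(z)])(1+m_\mu(z))=m_\mu(z)(1+m_\nu(z))$, $T_\nu(z)=\left(\frac1zR_\nu\right)\circ R_\nu^{\langle-1\rangle}(z)$,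 ${}^cT_{(\mu,\nu)}(z)=\left(\frac1z{}^cR_{(\mu,\nu)}\right)\circ R_\nu^{\langle-1\rangle}(z)$, where $\left(\frac1zF\right)\circ G$ is $F(z)/z$ composed with $G$. The multiplicative c-free convolution $(\mu_1,\nu_1)\boxtimes(\mu_2,\nu_2)$ of pairs in $\mathcal{M}_{\mathbb{T}}\times\mathcal{M}_{\mathbb{T}}^\times$ is the unique pair $(\mu,\nu)\in\mathcal{M}_{\mathbb{T}}\times\mathcal{M}_{\mathbb{T}}^\times$ with $T_\nu=T_{\nu_1}T_{\nu_2}$ and ${}^cT_{(\mu,\nu)}={}^cT_{(\mu_1,\nu_1)}{}^cT_{(\mu_2,\nu_2)}$. The multiplicative boolean convolution $\mu\uplus\nu$ of $\mu,\nu\in\mathcal{M}_{\mathbb{T}}$ is the unique measure in $\mathcal{M}_{\mathbb{T}}$ with $B_{\mu\uplus\nu}=B_\mu B_\nu$ on $\mathbb{D}$. *)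

(* Defs.v *)
From HB Require Import structures.
From mathcomp Require Import all_boot all_order all_algebra.
From mathcomp Require Import all_classical all_reals all_analysis.
From mathcomp Require Import measurable_realfun.
From mathcomp Require Export complex.
Set Implicit Arguments.
Unset Strict Implicit.
Unset Printing Implicit Defensive.
Import Order.TTheory GRing.Theory Num.Theory numFieldNormedType.Exports.
Local Open Scope classical_set_scope.
Local Open Scope ring_scope.
Local Open Scope complex_scope.

(* [R[i]] is a normed space over itself, so that [derivable f z 1] is complex
   differentiability and [nbhs] is the usual topology of the plane. *)
HB.instance Definition _ (R : rcfType) := NormedModule.copy R[i] R[i]^o.

Section circle.
Variable R : realType.

Definition circle : Type := set_type [set z : R[i] | `|z| = 1].

HB.instance Definition _ := Topological.on circle.

Definition cval (x : circle) : R[i] := set_val x.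

Lemma cval_continuous : continuous cval.
Proof. exact: initial_continuous. Qed.

Lemma cval_norm (x : circle) : `|cval x| = 1.
Proof. by case: x => x hx; exact: (set_mem hx). Qed.

Definition mkcircle (z : R[i]) (hz : `|z| = 1) : circle :=
  exist _ z (mem_set hz).

HB.instance Definition _ := isPointed.Build circle (mkcircle (normr1 _)).

HB.instance Definition _ :=
  Measurable.copy circle (g_sigma_algebraType (@open circle)).

Lemma norm_cis (t : R) : `|cos t +i* sin t| = 1 :> R[i].
Proof. by rewrite normc_def/= cos2Dsin2 sqrtr1. Qed.

Definition cis (t : R) : circle := mkcircle (norm_cis t).

Lemma cis_continuous : continuous cis.
Proof.
have cC : continuous (cval \o cis).
  move=> t; apply/cvgrPdist_lt => -[e1 e2]; rewrite ltcE/= => /andP[/eqP -> e0].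
  have e20 : 0 < e1 / 2 by rewrite divr_gt0.
  have /cvgrPdist_lt/(_ _ e20) Hc := @continuous_cos R t.
  have /cvgrPdist_lt/(_ _ e20) Hs := @continuous_sin R t.
  near=> s; rewrite /= /cval/=.
  have -> : (cos t +i* sin t) - (cos s +i* sin s) =
            (cos t - cos s)%:C + (sin t - sin s)%:C * 'i :> R[i].
    by simpc.
  apply: (le_lt_trans (ler_normD _ _)).
  rewrite normrM !normc_def/= !expr0n/= expr1n !addr0 add0r sqrtr1 !sqrtr_sqr.
  rewrite mulr1 -rmorphD/= ltcR [ltRHS]splitr ltrD//.
    by near: s; exact: Hc.
  by near: s; exact: Hs.
apply/continuousP => A [B oB <-].
by move/continuousP: cC => /(_ _ oB).
Unshelve. all: by end_near. Qed.

Lemma measurable_cis : @measurable_fun _ _ (measurableTypeR R) circle setT cis.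
Proof.
apply: (measurability (@open circle)) => //.
move=> _ [A oA <-]; rewrite setTI; apply: open_measurable.
by move/continuousP: cis_continuous; exact.
Qed.

Definition point_mass (x : circle) : probability circle R := \d_x.

(* Normalized arc length: the image of the uniform law on [0, 2 pi]. *)
Definition haar : probability circle R :=
  distribution (uniform_prob (mulr_gt0 (ltr0n R 2) (pi_gt0 R)))
    (@mfun_Sub _ _ (measurableTypeR R) circle cis (mem_set measurable_cis)).

(* Test functions need no boundedness hypothesis: the circle is compact. *)
Definition weak_cvg (mu_ : nat -> probability circle R)
    (mu : probability circle R) : Prop :=
  forall f : circle -> R, continuous f ->
    (fun n => \int[mu_ n]_x f x) @ \oo --> \int[mu]_x f x.

Definition infinitesimal (k : nat -> nat)
    (mu : forall n, 'I_(k n) -> probability circle R) : Prop :=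
  forall e : R, 0 < e ->
    (fun n => \big[maxe/0%E]_(i < k n)
       mu n i [set x | e%:C <= `|cval x - 1|]) @ \oo --> 0%E.

End circle.

Section transforms.
Variable R : realType.
Local Notation C := R[i].
Local Notation PT := (probability (circle R) R).

Definition cintegral (mu : PT) (f : circle R -> C) : C :=
  (\int[mu]_x complex.Re (f x)) +i* (\int[mu]_x complex.Im (f x)).

Definition mean (mu : PT) : C := cintegral mu (@cval R).

Definition nonzero_mean (mu : PT) : Prop := mean mu != 0.

Definition mtransf (mu : PT) (z : C) : C :=
  cintegral mu (fun x => z * cval x / (1 - z * cval x)).

(* The quotient has a removable singularity at 0, where its value is the mean
   of [mu]. *)
Definition Btransf (mu : PT) (z : C) : C :=
  if z == 0 then mean mu else mtransf mu z / (z * (1 + mtransf mu z)).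

Definition analytic_near0 (f : C -> C) : Prop :=
  \forall z \near (0 : C), derivable f z 1.

(* [G] is the inverse of [F] under composition near 0. *)
Definition inverse_near0 (F G : C -> C) : Prop :=
  [/\ F 0 = 0, G 0 = 0, analytic_near0 G,
      \forall z \near (0 : C), F (G z) = z &
      \forall z \near (0 : C), G (F z) = z].

(* The transforms below are germs at 0 of analytic functions; they are given as
   relations ``the function is a representative of the germ''. *)
Definition is_R (nu : PT) (F : C -> C) : Prop :=
  analytic_near0 F /\
  \forall z \near (0 : C), F (z * (1 + mtransf nu z)) = mtransf nu z.

Definition is_cR (mu nu : PT) (F : C -> C) : Prop :=
  analytic_near0 F /\
  \forall z \near (0 : C), F (z * (1 + mtransf nu z)) * (1 + mtransf mu z) =
    mtransf mu z * (1 + mtransf nu z).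

(* [F(z)/z] has a removable singularity at 0, hence so has its composition with
   [G]; the punctured neighbourhood and analyticity of [T] fix [T 0]. *)
Definition is_quot_comp (F G T : C -> C) : Prop :=
  analytic_near0 T /\ \forall z \near (0 : C)^', T z = F (G z) / G z.

Definition is_T (nu : PT) (T : C -> C) : Prop :=
  exists F G, [/\ is_R nu F, inverse_near0 F G & is_quot_comp F G T].

Definition is_cT (mu nu : PT) (T : C -> C) : Prop :=
  exists F G H, [/\ is_R nu F, inverse_near0 F G, is_cR mu nu H &
    is_quot_comp H G T].

(* [cfree_conv p1 p2 p]: [p = p1 \boxtimes p2], the multiplicative c-free
   convolution on pairs whose second component has nonzero mean. *)
Definition cfree_conv (p1 p2 p : PT * PT) : Prop :=
  [/\ [/\ nonzero_mean p1.2, nonzero_mean p2.2 & nonzero_mean p.2],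
      exists T1 T2 T, [/\ is_T p1.2 T1, is_T p2.2 T2, is_T p.2 T &
        \forall z \near (0 : C), T z = T1 z * T2 z] &
      exists T1 T2 T, [/\ is_cT p1.1 p1.2 T1, is_cT p2.1 p2.2 T2,
        is_cT p.1 p.2 T & \forall z \near (0 : C), T z = T1 z * T2 z]].

(* [bool_conv mu1 mu2 mu]: [mu = mu1 \uplus mu2]. *)
Definition bool_conv (mu1 mu2 mu : PT) : Prop :=
  forall z : C, `|z| < 1 -> Btransf mu z = Btransf mu1 z * Btransf mu2 z.

End transforms.

(* [iter_op op x [:: y1; ...; yk] z]: [z = (x * y1) * ... * yk] for the binary
   operation with graph [op]. *)
Fixpoint iter_op (T : Type) (op : T -> T -> T -> Prop) (x : T) (s : seq T)
    (z : T) : Prop :=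
  if s is y :: s' then exists2 w, op x y w & iter_op op w s' z else z = x.

(* Main.v *)
(* Both statements are equivalent to the convergence of
   [\prod_k |mean (mu n k)|] to [0].

   Since [cT (psi_nu z) = B_mu z] near [0], where [psi_nu = mtransf nu], there is for
   each [N] a polynomial [t] with [t (psi_nu z) = B_mu z + O(z ^ N.+1)], and these
   polynomials multiply under the c-free convolution; for the boolean convolution
   the same holds with [psi_nu] replaced by the identity. The constant coefficient
   of [t] is [a = mean mu], and the others are at most [C (1 - |a|)] with [C]
   depending on [N] only, once [|mean nu| >= 1/2]: this comes from
   [m_(j+1) - a m_j = \int (zeta - a) (zeta ^ j - a ^ j)] together with
   [\int |zeta - a| ^ 2 = 1 - |a| ^ 2]. In the norm [\sum_(j <= N) |p_j| r ^ j] with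
   [r] small, each factor is then at most [|a| ^ (1/3)], a substitute for Harnack's
   inequality that needs no function theory on the disk. Hence all moments of
   [mu_ n] and of [rho_ n] are controlled by the common modulus
   [\prod_k |mean (mu n k)|] of their means, and moments converging to [0] mean weak
   convergence to Haar measure, by the Fejer kernel. *)

Require Import Defs.
From HB Require Import structures.
From mathcomp Require Import all_boot all_order all_algebra.
From mathcomp Require Import all_classical all_reals all_analysis.
From mathcomp Require Import measurable_realfun ring lra.
Set Implicit Arguments.
Unset Strict Implicit.
Unset Printing Implicit Defensive.
Import Order.TTheory GRing.Theory Num.Theory numFieldNormedType.Exports.
Import Normc.
Local Open Scope classical_set_scope.
Local Open Scope ring_scope.
Local Open Scope complex_scope.

(** * Complex numbers and the topology of the circle *)

(** The transforms are germs given by relations and composed with a local inverse, so no power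
    series is summed: every expansion has finite order and an error [O(z ^ N.+1)] on a punctured
    neighbourhood of 0. This is enough, since each moment is read off from finitely many
    coefficients. The number of factors is unbounded, so a constant lost in each of them would be
    fatal. This is why the non-constant coefficients must be bounded linearly in [1 - |a|]: the
    weight [r] then absorbs the constant inside each factor, and returning to the weight 1 costs
    [r ^- N] only once, for the whole product. Composition with [psi] is inverted only for the
    single factors, where infinitesimality keeps the mean of [nu n i] away from 0. For the product
    it is applied in the forward direction, where a bound on the moments of [nu_ n] suffices. *)

Section normc_theory.
Variable R : rcfType.
Implicit Types x y z : R[i].

Lemma normc_ge0 z : 0 <= normc z.
Proof. by case: z => a b; exact: sqrtr_ge0. Qed.

Lemma normcX z n : normc (z ^+ n) = normc z ^+ n.
Proof. by elim: n => [|n ih]; rewrite ?expr0 ?normc1// !exprS normcM ih. Qed.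

Lemma normc_eq0 z : (normc z == 0) = (z == 0).
Proof. by apply/eqP/eqP => [/eq0_normc//|->]; rewrite normc0. Qed.

Lemma normc_gt0 z : (0 < normc z) = (z != 0).
Proof. by rewrite lt_def normc_ge0 andbT normc_eq0. Qed.

Lemma normc_real (a : R) : normc a%:C = `|a|.
Proof. by rewrite /= expr0n/= addr0 sqrtr_sqr. Qed.

Lemma normcB x y : normc (x - y) <= normc x + normc y.
Proof. by rewrite -(normcN y) le_normcD. Qed.

Lemma normcD_ge x y : normc x - normc y <= normc (x + y).
Proof.
by rewrite lerBlDr -(normcN y); apply: le_trans (le_normcD _ _); rewrite addrK.
Qed.

Lemma normcB_ge x y : normc x - normc y <= normc (x - y).
Proof. by rewrite -(normcN y) normcD_ge. Qed.

Lemma normc_distC x y : normc (x - y) = normc (y - x).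
Proof. by rewrite -normcN opprB. Qed.

Lemma normc_sum (I : Type) (s : seq I) (P : pred I) (F : I -> R[i]) :
  normc (\sum_(i <- s | P i) F i) <= \sum_(i <- s | P i) normc (F i).
Proof.
elim/big_ind2 : _ => [|a b c d ab cd|//]; first by rewrite normc0.
by rewrite (le_trans (le_normcD _ _))// lerD.
Qed.

Lemma normc_prod (I : Type) (s : seq I) (P : pred I) (F : I -> R[i]) :
  normc (\prod_(i <- s | P i) F i) = \prod_(i <- s | P i) normc (F i).
Proof. by apply: big_morph; [exact: normcM|exact: normc1]. Qed.

Lemma normc_conj z : normc z^* = normc z.
Proof. by case: z => a b /=; rewrite sqrrN. Qed.

Lemma normc_conjM z : z * z^* = (normc z ^+ 2)%:C.
Proof.
case: z => a b /=; rewrite sqr_sqrtr ?addr_ge0 ?sqr_ge0//.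
by simpc; congr (_ +i* _); ring.
Qed.

Lemma normc_Re z : `|complex.Re z| <= normc z.
Proof. by rewrite -lecR; exact: normc_ge_Re. Qed.

Lemma normc_Im z : `|complex.Im z| <= normc z.
Proof. by case: z => a b /=; rewrite -sqrtr_sqr ler_wsqrtr// lerDr sqr_ge0. Qed.

Lemma normc_le_ReIm z : normc z <= `|complex.Re z| + `|complex.Im z|.
Proof.
case: z => a b /=.
rewrite -(ger0_norm (addr_ge0 (normr_ge0 a) (normr_ge0 b))) -sqrtr_sqr.
rewrite ler_wsqrtr// sqrrD !real_normK ?num_real//.
by rewrite lerD2r lerDl mulrn_wge0// mulr_ge0.
Qed.

End normc_theory.

Section circle_continuity.
Variable R : realType.
Local Notation C := R[i].

(** The norm of [R[i]] takes values in [R[i]], so balls have complex radii; positivity forces such a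
    radius to be real, and neighbourhoods can be described by the real-valued [normc]. *)
Lemma nbhs_normcP (z : C) (P : set C) :
  nbhs z P <-> exists2 d : R, 0 < d & forall w, normc (z - w) < d -> P w.
Proof.
split.
  move=> /nbhs_ballP[[d d']]; rewrite /= ltcE/= => /andP[/eqP -> d0] H.
  exists d => // w zd; apply: H; rewrite -ball_normE/=.
  by rewrite -[X in X < _]/((normc _)%:C) ltcR.
move=> [d d0 H]; apply/nbhs_ballP; exists d%:C; first by rewrite /= ltcR.
move=> w; rewrite -ball_normE/=.
by rewrite -[X in X < _]/((normc _)%:C) ltcR; exact: H.
Qed.

Lemma Re_continuous : continuous (@complex.Re R : C -> R).
Proof.
move=> z A /nbhs_ballP[e e0 H]; apply/nbhs_normcP; exists e => // w zw /=.
apply: H; rewrite -ball_normE /= -(raddfB (@complex.Re R : Rcomplex R -> R)).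
exact: le_lt_trans (normc_Re _) zw.
Qed.

Lemma Im_continuous : continuous (@complex.Im R : C -> R).
Proof.
move=> z A /nbhs_ballP[e e0 H]; apply/nbhs_normcP; exists e => // w zw /=.
apply: H; rewrite -ball_normE /= -(raddfB (@complex.Im R : Rcomplex R -> R)).
exact: le_lt_trans (normc_Im _) zw.
Qed.

Lemma near0P (P : C -> Prop) :
  (\forall z \near (0 : C), P z) <->
  exists2 d : R, 0 < d & forall z, normc z < d -> P z.
Proof.
split=> [/nbhs_normcP|] [d d0 H]; [|apply/nbhs_normcP]; exists d => // z zd;
  by apply: H; move: zd; rewrite sub0r normcN.
Qed.

(** [acos] of the real part is the angle up to sign, and the sign of the imaginary part decides.
    This makes the circle the image of a segment, hence compact. *)
Lemma circle_cis (x : circle R) : exists2 t, t \in `[- pi, pi] & x = cis t.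
Proof.
have := cval_norm x; case: x => -[a b] h; rewrite {1}/cval /=.
rewrite normc_def /= => -[/eqP]; rewrite -(sqrtr1 R) => nab.
have {}nab : a ^+ 2 + b ^+ 2 = 1.
  by apply/eqP; rewrite -eqr_sqrt// addr_ge0 ?sqr_ge0.
have a1 : -1 <= a <= 1.
  rewrite -ler_norml -(@ler_pXn2r _ 2)// ?nnegrE// expr1n real_normK ?num_real//.
  by rewrite -nab lerDl sqr_ge0.
have a1' : a \in `[(-1), 1] by rewrite in_itv.
have sa : Num.sqrt (1 - a ^+ 2) = `|b|.
  by rewrite -nab addrC addKr sqrtr_sqr.
have /andP[ac0 acpi] : 0 <= acos a <= pi by rewrite acos_ge0// acos_lepi.
have [b0|b0] := leP 0 b.
  exists (acos a).
    by rewrite in_itv/= acpi andbT (le_trans _ ac0)// oppr_le0 pi_ge0.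
  apply: val_inj => /=; rewrite acosK// sin_acos// sa.
  by rewrite ger0_norm.
exists (- acos a).
  rewrite in_itv/= lerN2 acpi/= (le_trans _ (pi_ge0 R))//.
  by rewrite oppr_le0.
apply: val_inj => /=; rewrite cosN sinN acosK// sin_acos// sa.
by rewrite ltr0_norm// opprK.
Qed.

Lemma circle_compact : compact [set: circle R].
Proof.
have -> : [set: circle R] = @cis R @` `[- pi, pi].
  apply/seteqP; split => [x _|//].
  by have [t tpi ->] := circle_cis x; exists t.
apply: continuous_compact; last exact: segment_compact.
exact/continuous_subspaceT/cis_continuous.
Qed.

(** Heine-Cantor, with the distance of the ambient plane. The covering form of compactness lets the
    radius and the centre vary together, so no finite subcover is extracted. *)
Lemma circle_unif_continuous (f : circle R -> R) : continuous f ->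
  forall e, 0 < e -> exists2 d, 0 < d &
    forall x y, normc (cval x - cval y) < d -> `|f x - f y| < e.
Proof.
move=> cf e e0.
have /compact_near_coveringP H := circle_compact.
pose P d x := forall y, normc (cval x - cval y) < d -> `|f x - f y| < e.
suff near0 : \forall d \near 0^'+, [set: circle R] `<=` P d.
  have [d [Hd d0]] := filter_ex (filterI near0 (nbhs_right_gt 0)).
  by exists d => // x y; exact: Hd.
apply: H.
move=> x _.
have /cvgrPdist_lt/(_ (e/2) (divr_gt0 e0 (ltr0n R 2))) := cf x.
move=> [_ [[A oA <-] Ax HA]].
have /nbhs_normcP[d d0 Hd] : nbhs (cval x) A by exact: open_nbhs_nbhs.
have Hb y : normc (cval x - cval y) < d -> `|f x - f y| < e / 2.
  by move=> xy; apply: HA => /=; exact: Hd.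
have d20 : 0 < d / 2 by rewrite divr_gt0.
exists ([set y | normc (cval x - cval y) < d/2], [set r | r < d / 2]) => /=.
  split; last by apply: nbhs_right_lt.
  apply: (@cval_continuous R x [set w | normc (cval x - w) < d / 2]).
  by apply/nbhs_normcP; exists (d / 2).
move=> [y r] /= [xy rd] z yz.
have : `|f x - f y| < e / 2 by apply: Hb; apply: lt_trans xy _; lra.
have : `|f x - f z| < e / 2.
  apply: Hb; rewrite -(subrKA (cval y)) (le_lt_trans (le_normcD _ _))//.
  by lra.
rewrite !ltr_norml; lra.
Qed.

End circle_continuity.

(** * Integration of continuous complex functions *)

Section complex_integral.
Variable R : realType.
Local Notation C := R[i].
Local Notation PT := (probability (circle R) R).
Implicit Types (mu : PT) (f g : circle R -> C) (u v : circle R -> R).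

Lemma circle_measurable u : continuous u ->
  @measurable_fun _ _ (circle R) (measurableTypeR R) setT u.
Proof.
move=> cu; apply: (measurability _ (RGenOpens.measurableE R)).
move=> _ [_ [a [b ->] <-]]; rewrite setTI; apply: sub_sigma_algebra.
by move/continuousP: cu; apply; exact: interval_open.
Qed.

Lemma circle_bounded u : continuous u -> exists M, forall x, `|u x| <= M.
Proof.
move=> cu; have := continuous_compact (continuous_subspaceT cu) (@circle_compact R).
move=> /compact_bounded[M [_ HM]]; exists (M + 1) => x.
by apply: (HM (M + 1)); rewrite ?ltrDl//; exists x.
Qed.

Lemma circle_integrable mu u : continuous u -> mu.-integrable setT (EFin \o u).
Proof.
move=> cu; apply: measurable_bounded_integrable => //.
- by rewrite [X in (X < _)%E](_ : _ = 1%E) ?ltry//; exact: probability_setT.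
- exact: circle_measurable.
- have [M HM] := circle_bounded cu; exists M; split; rewrite ?num_real// => N MN x _.
  exact: le_trans (HM x) (ltW MN).
Qed.

(** Continuity is split into components to match [cintegral], which integrates the real and
    imaginary parts separately. *)
Definition ccont f :=
  continuous (fun x => complex.Re (f x)) /\ continuous (fun x => complex.Im (f x)).

Lemma ccont_cst c : ccont (fun=> c).
Proof. by split; exact: cst_continuous. Qed.

Lemma ccont_real u : continuous u -> ccont (fun x => (u x)%:C).
Proof. by split=> //; exact: cst_continuous. Qed.

Lemma rcontD u v : continuous u -> continuous v -> continuous (fun x => u x + v x).
Proof. by move=> cu cv x; exact: (cvgD (cu x) (cv x)). Qed.

Lemma rcontN u : continuous u -> continuous (fun x => - u x).
Proof. by move=> cu x; exact: (cvgN (cu x)). Qed.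

Lemma rcontM u v : continuous u -> continuous v -> continuous (fun x => u x * v x).
Proof. by move=> cu cv x; exact: (cvgM (cu x) (cv x)). Qed.

Lemma rcont_cst (k : R) : continuous (fun _ : circle R => k).
Proof. exact: cst_continuous. Qed.

Lemma rcont_norm u : continuous u -> continuous (fun x => `|u x|).
Proof. by move=> cu x; exact: (cvg_norm (cu x)). Qed.

Lemma ccontD f g : ccont f -> ccont g -> ccont (fun x => f x + g x).
Proof.
move=> [rf jf] [rg jg]; split.
  rewrite (_ : (fun _ => _) = (fun x => complex.Re (f x) + complex.Re (g x))).
    exact: rcontD.
  by apply/funext => y; case: (f y) (g y) => ? ? [].
rewrite (_ : (fun _ => _) = (fun x => complex.Im (f x) + complex.Im (g x))).
  exact: rcontD.
by apply/funext => y; case: (f y) (g y) => ? ? [].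
Qed.

Lemma ccontM f g : ccont f -> ccont g -> ccont (fun x => f x * g x).
Proof.
move=> [rf jf] [rg jg]; split.
  rewrite (_ : (fun _ => _) = (fun x =>
    complex.Re (f x) * complex.Re (g x) + - (complex.Im (f x) * complex.Im (g x)))).
    by apply: rcontD; [|apply: rcontN]; exact: rcontM.
  by apply/funext => y; case: (f y) (g y) => ? ? [].
rewrite (_ : (fun _ => _) = (fun x =>
    complex.Re (f x) * complex.Im (g x) + complex.Im (f x) * complex.Re (g x))).
  by apply: rcontD; exact: rcontM.
by apply/funext => y; case: (f y) (g y) => ? ? [].
Qed.

Lemma ccont_conj f : ccont f -> ccont (fun x => (f x)^*).
Proof.
move=> [rf jf]; split.
  by rewrite (_ : (fun _ => _) = (fun x => complex.Re (f x)))//;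
    apply/funext => y; case: (f y).
rewrite (_ : (fun _ => _) = (fun x => - complex.Im (f x))); first exact: rcontN.
by apply/funext => y; case: (f y).
Qed.

Lemma ccontN f : ccont f -> ccont (fun x => - f x).
Proof.
move=> cf; rewrite (_ : (fun _ => _) = (fun x => -1 * f x)).
  exact: ccontM (ccont_cst _) cf.
by apply/funext => x; rewrite mulN1r.
Qed.

Lemma ccontB f g : ccont f -> ccont g -> ccont (fun x => f x - g x).
Proof. by move=> cf cg; apply: ccontD => //; exact: ccontN. Qed.

Lemma ccontX f n : ccont f -> ccont (fun x => f x ^+ n).
Proof.
move=> cf; elim: n => [|n ih]; first exact: ccont_cst.
by under eq_fun do rewrite exprS; exact: ccontM.
Qed.

Lemma ccont_sum (I : Type) (s : seq I) (F : I -> circle R -> C) :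
  (forall i, ccont (F i)) -> ccont (fun x => \sum_(i <- s) F i x).
Proof.
move=> cF; elim: s => [|i s ih].
  by under eq_fun do rewrite big_nil; exact: ccont_cst.
by under eq_fun do rewrite big_cons; exact: ccontD.
Qed.

Lemma normc_continuous f : ccont f -> continuous (fun x => normc (f x)).
Proof.
move=> [rf jf].
rewrite (_ : (fun _ => _) = Num.sqrt \o (fun x => complex.Re (f x) * complex.Re (f x) +
    complex.Im (f x) * complex.Im (f x))).
  move=> x; apply: continuous_comp; last exact: sqrt_continuous.
  by apply: rcontD; exact: rcontM.
by apply/funext => y /=; case: (f y) => a b /=; rewrite !expr2.
Qed.

Lemma ccontV f : ccont f -> (forall x, f x != 0) -> ccont (fun x => (f x)^-1).
Proof.
move=> cf f0.
rewrite (_ : (fun _ => _) =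
    (fun x => ((normc (f x))^-1 * (normc (f x))^-1)%:C * (f x)^*)).
  apply: ccontM; last exact: ccont_conj.
  have cV : continuous (fun x => (normc (f x))^-1).
    move=> x; have fx0 : normc (f x) != 0 by rewrite normc_eq0.
    exact: cvgV fx0 (normc_continuous cf (x := x)).
  exact/ccont_real/rcontM.
apply/funext => x; apply: (mulfI (f0 x)); rewrite mulfV// mulrCA normc_conjM.
by rewrite -rmorphM/= -expr2 -exprMn mulVf ?expr1n// normc_eq0.
Qed.

Lemma ccont_cval : ccont (@cval R).
Proof.
split=> x; apply: (@continuous_comp _ _ _ (@cval R)); try exact: cval_continuous.
  exact: Re_continuous.
exact: Im_continuous.
Qed.

Lemma cintegralD mu f g : ccont f -> ccont g ->
  cintegral mu (fun x => f x + g x) = cintegral mu f + cintegral mu g.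
Proof.
move=> [rf jf] [rg jg]; rewrite /cintegral.
rewrite -[RHS]/((_ + _) +i* (_ + _)) -!RintegralD//; try exact: circle_integrable.
by congr (_ +i* _); apply: eq_Rintegral => x _; case: (f x) (g x) => ? ? [].
Qed.

Lemma cintegralZ mu c f : ccont f ->
  cintegral mu (fun x => c * f x) = c * cintegral mu f.
Proof.
case: c => a b [rf jf]; rewrite /cintegral.
have cZ k u : continuous u -> continuous (fun x => k * u x).
  exact/rcontM/rcont_cst.
rewrite -[RHS]/((_ - _) +i* (_ + _)) -!RintegralZl//; try exact: circle_integrable.
rewrite -RintegralB// -?RintegralD//; try by apply: circle_integrable; exact: cZ.
by congr (_ +i* _); apply: eq_Rintegral => x _; case: (f x).
Qed.

Lemma cintegralB mu f g : ccont f -> ccont g ->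
  cintegral mu (fun x => f x - g x) = cintegral mu f - cintegral mu g.
Proof.
move=> cf cg; under [in LHS]eq_fun do rewrite -mulN1r.
by rewrite cintegralD ?cintegralZ ?mulN1r//; apply: ccontM => //; exact: ccont_cst.
Qed.

Lemma cintegral_cst mu c : cintegral mu (fun=> c) = c.
Proof.
rewrite /cintegral !Rintegral_cst//= [mu _](_ : _ = 1%E) ?mulr1; last first.
  exact: probability_setT.
by case: c.
Qed.

Lemma cintegral_sum mu (I : Type) (s : seq I) (F : I -> circle R -> C) :
  (forall i, ccont (F i)) ->
  cintegral mu (fun x => \sum_(i <- s) F i x) = \sum_(i <- s) cintegral mu (F i).
Proof.
move=> cF; elim: s => [|i s ih].
  by under eq_fun do rewrite big_nil; rewrite cintegral_cst big_nil.
by under eq_fun do rewrite big_cons; rewrite cintegralD ?ih ?big_cons//; exact: ccont_sum.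
Qed.

Lemma cintegral_real mu u : cintegral mu (fun x => (u x)%:C) = (\int[mu]_x u x)%:C.
Proof. by rewrite /cintegral/= Rintegral_cst// mul0r. Qed.

(* The constant [2] comes from treating the two components separately. *)
Lemma normc_cintegral mu f u : ccont f -> continuous u ->
  (forall x, normc (f x) <= u x) -> normc (cintegral mu f) <= 2 * \int[mu]_x u x.
Proof.
move=> [rf jf] cu fu; rewrite (le_trans (normc_le_ReIm _))//= mulr2n mulrDl mul1r.
have H v : continuous v -> (forall x, `|v x| <= u x) ->
    `|\int[mu]_x v x| <= \int[mu]_x u x.
  move=> cv vu; apply: le_trans (le_normr_Rintegral _ _) _ => //.
    exact: circle_integrable.
  apply: le_Rintegral => //; try exact: circle_integrable.
  exact/circle_integrable/rcont_norm.
by apply: lerD; apply: H => // x; apply: le_trans (fu x); [exact: normc_Re|exact: normc_Im].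
Qed.

Lemma normc_cintegral_cst mu f (M : R) : ccont f ->
  (forall x, normc (f x) <= M) -> normc (cintegral mu f) <= 2 * M.
Proof.
move=> cf fM; have := normc_cintegral mu cf (@rcont_cst M) fM.
by rewrite Rintegral_cst//= [mu _](_ : _ = 1%E) ?mulr1//; exact: probability_setT.
Qed.

End complex_integral.

(** * Moments *)

Section moments.
Variable R : realType.
Local Notation C := R[i].
Local Notation PT := (probability (circle R) R).
Implicit Types (mu : PT).

Definition moment mu j : C := cintegral mu (fun x => cval x ^+ j).

Lemma normc_cval (x : circle R) : normc (cval x) = 1.
Proof. by have := cval_norm x; case: (cval x) => a b [<-]. Qed.

Lemma ccont_cvalX j : ccont (fun x : circle R => cval x ^+ j).
Proof. exact/ccontX/ccont_cval. Qed.

Lemma moment0 mu : moment mu 0 = 1.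
Proof. exact: cintegral_cst. Qed.

Lemma moment1 mu : moment mu 1 = mean mu.
Proof. by []. Qed.

(** The 2 is the factor of the componentwise estimate; it only enters constants. *)
Lemma moment_le2 mu j : normc (moment mu j) <= 2.
Proof.
rewrite -[leRHS]mulr1; apply: normc_cintegral_cst => [|x]; first exact: ccont_cvalX.
by rewrite normcX normc_cval expr1n.
Qed.

Lemma cintegral_conj mu f : ccont f ->
  cintegral mu (fun x => (f x)^*) = (cintegral mu f)^*.
Proof.
move=> [rf jf]; rewrite /cintegral -[RHS]/(_ +i* - _).
congr (_ +i* _); first by apply: eq_Rintegral => x _; case: (f x).
rewrite -mulN1r -RintegralZl//; last exact: circle_integrable.
by apply: eq_Rintegral => x _; rewrite mulN1r; case: (f x).
Qed.

Lemma variance_circle mu :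
  \int[mu]_x (normc (cval x - mean mu) ^+ 2) = 1 - normc (mean mu) ^+ 2.
Proof.
set a := mean mu; have cc := @ccont_cval R; have ccs := ccont_conj cc.
apply: (@complexI R); rewrite -cintegral_real.
have -> : (1 - normc a ^+ 2)%:C = 1 - a * a^* by rewrite rmorphB/= normc_conjM.
rewrite (_ : (fun x => _) =
    (fun x => (1 - a * (cval x)^* - a^* * cval x) + a * a^*)); last first.
  apply/funext => x; rewrite -normc_conjM rmorphB/= mulrBl !mulrBr.
  by rewrite normc_conjM normc_cval expr1n rmorph1; ring.
have ca := @ccont_cst R; have cM := @ccontM R.
have c1 : ccont (fun x : circle R => a * (cval x)^*) by exact: cM.
have c2 : ccont (fun x : circle R => a^* * cval x) by exact: cM.
have c3 : ccont (fun x : circle R => 1 - a * (cval x)^*) by exact: ccontB.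
have c4 : ccont (fun x : circle R => 1 - a * (cval x)^* - a^* * cval x).
  exact: ccontB.
rewrite cintegralD// !cintegralB// !cintegral_cst !cintegralZ// cintegral_conj//.
by rewrite -/(mean mu) -/a; ring.
Qed.

(** Here the sharp constant matters, since [1 - |a|] has to be nonnegative; it comes from the sign
    of the variance rather than from the lossy integral estimate. *)
Lemma normc_mean_le1 mu : normc (mean mu) <= 1.
Proof.
have : 0 <= \int[mu]_x (normc (cval x - mean mu) ^+ 2).
  by apply: Rintegral_ge0 => x _; rewrite sqr_ge0.
by rewrite variance_circle subr_ge0 expr_le1// normc_ge0.
Qed.

(* The factor [zeta - a] has mean zero, so [zeta ^ j] may be replaced by
   [zeta ^ j - a ^ j], which gains a second factor [zeta - a]. *)
Lemma moment_drift mu j :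
  normc (moment mu j.+1 - mean mu * moment mu j) <= 4 * j%:R * (1 - normc (mean mu)).
Proof.
set a := mean mu; have a1 : normc a <= 1 := normc_mean_le1 mu.
have cc := @ccont_cval R; have cX := ccont_cvalX; have ca := @ccont_cst R.
have cxa : ccont (fun x : circle R => cval x - a) by exact: ccontB.
have -> : moment mu j.+1 - a * moment mu j =
    cintegral mu (fun x => (cval x - a) * (cval x ^+ j - a ^+ j)).
  under eq_fun do rewrite mulrBr.
  rewrite cintegralB; [|by apply: ccontM => //; exact: ccontB|exact: ccontM].
  under [X in _ = _ - cintegral _ X]eq_fun do rewrite mulrC.
  rewrite cintegralZ// cintegralB// cintegral_cst -/(mean mu) subrr mulr0 subr0.
  under [in RHS]eq_fun do rewrite mulrBl -exprS.
  by rewrite cintegralB ?cintegralZ//; apply: ccontM.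
pose u (x : circle R) := j%:R * normc (cval x - a) ^+ 2.
have cu2 : continuous (fun x : circle R => normc (cval x - a) ^+ 2).
  by apply: rcontM; exact: normc_continuous.
have cu : continuous u by apply: rcontM => //; exact: rcont_cst.
apply: le_trans (normc_cintegral mu _ cu _) _.
- by apply: ccontM => //; exact: ccontB.
(* [zeta ^ j - a ^ j] is [zeta - a] times a sum of [j] terms of modulus at most 1. *)
- move=> x; rewrite /u subrXX !normcM mulrA -expr2 mulrC.
  rewrite ler_wpM2r ?sqr_ge0// (le_trans (normc_sum _ _ _))//.
  rewrite -[leRHS]mulr1 -[j in leRHS]card_ord -sum1_card natr_sum mulr_suml.
  apply: ler_sum => i _; rewrite mulr1 normcM !normcX normc_cval expr1n mul1r.
  by rewrite exprn_ile1// normc_ge0.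
rewrite RintegralZl//; last exact: circle_integrable.
rewrite variance_circle -/a.
(* [1 - A ^ 2 = 2 * (1 - A) - (1 - A) ^ 2], and the square is discarded. *)
have := mulr_ge0 (ler0n R j) (sqr_ge0 (1 - normc a)).
by move: (j%:R : R) (normc a) => J A; nra.
Qed.

Lemma normc_mulcval z (x : circle R) : normc (z * cval x) = normc z.
Proof. by rewrite normcM normc_cval mulr1. Qed.

Lemma one_sub_neq0 (z : C) (x : circle R) : normc z <= 1/2 -> 1 - z * cval x != 0.
Proof.
move=> z2; rewrite -normc_gt0; apply: lt_le_trans (normcB_ge _ _).
by rewrite normc1 normc_mulcval; lra.
Qed.

Lemma normc_inv_one_sub (z : C) (x : circle R) : normc z <= 1/2 ->
  normc (1 - z * cval x)^-1 <= 2.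
Proof.
move=> z2; rewrite normcV invf_ple ?posrE//; last by rewrite normc_gt0 one_sub_neq0.
by apply: le_trans (normcB_ge _ _); rewrite normc1 normc_mulcval; lra.
Qed.

Lemma ccont_zcval (z : C) : ccont (fun x : circle R => z * cval x).
Proof. by apply: ccontM; [exact: ccont_cst|exact: ccont_cval]. Qed.

Lemma ccont_inv_one_sub (z : C) : normc z <= 1/2 ->
  ccont (fun x : circle R => (1 - z * cval x)^-1).
Proof.
move=> z2; apply: ccontV => [|x]; last exact: one_sub_neq0.
by apply: ccontB; [exact: ccont_cst|exact: ccont_zcval].
Qed.

(** With [w = z * zeta], the geometric series leaves the remainder [w ^ N.+1 / (1 - w)] under the
    integral. The 4 is the bound 2 on [1 / (1 - w)] times the 2 of [normc_cintegral]. *)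
Lemma mtransf_taylor mu N (z : C) : normc z <= 1/2 ->
  normc (mtransf mu z - \sum_(j < N) moment mu j.+1 * z ^+ j.+1) <=
    4 * normc z ^+ N.+1.
Proof.
move=> z2; have cX := ccont_cvalX; have cz := ccont_zcval z.
have ci := ccont_inv_one_sub z2.
have -> : mtransf mu z - \sum_(j < N) moment mu j.+1 * z ^+ j.+1 =
    cintegral mu (fun x => (z * cval x) ^+ N.+1 * (1 - z * cval x)^-1).
  have -> : \sum_(j < N) moment mu j.+1 * z ^+ j.+1 =
      cintegral mu (fun x => \sum_(j < N) z ^+ j.+1 * cval x ^+ j.+1).
    rewrite cintegral_sum => [|j]; last by apply: ccontM => //; exact: ccont_cst.
    by apply: eq_bigr => j _; rewrite cintegralZ// mulrC.
  rewrite -cintegralB; [|exact: ccontM|]; last first.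
    by apply: ccont_sum => j; apply: ccontM => //; exact: ccont_cst.
  congr cintegral; apply/funext => x.
  have x0 := one_sub_neq0 x z2; apply: (mulIf x0).
  rewrite mulrBl !divfK//.
  under eq_bigr do rewrite -exprMn exprS.
  rewrite -mulr_sumr -mulrA [X in _ - _ * X](_ : _ = 1 - (z * cval x) ^+ N).
    by rewrite exprS; ring.
  by rewrite mulrC -[1 in RHS](expr1n _ N) subrXX; congr (_ * _);
    apply: eq_bigr => i _; rewrite expr1n mul1r.
rewrite (_ : 4 * _ = 2 * (2 * normc z ^+ N.+1)); last by ring.
apply: normc_cintegral_cst => [|x]; first by apply: ccontM => //; exact: ccontX.
by rewrite normcM normcX normc_mulcval mulrC ler_wpM2r ?exprn_ge0 ?normc_ge0//
   normc_inv_one_sub.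
Qed.

Lemma mtransf_le mu (z : C) : normc z <= 1/2 -> normc (mtransf mu z) <= 4 * normc z.
Proof. by move=> /(mtransf_taylor mu 0); rewrite big_ord0 subr0 expr1. Qed.

Lemma mtransf_linear mu (z : C) : normc z <= 1/2 ->
  normc (mtransf mu z - mean mu * z) <= 4 * normc z ^+ 2.
Proof. by move=> /(mtransf_taylor mu 1); rewrite big_ord1 !expr1. Qed.

(** The part beyond the linear term has a Lipschitz constant that shrinks with [r], which makes the
    iteration for local surjectivity a contraction. The integrand contributes [3 * r * 2 * 2], and
    the integral estimate doubles it. *)
Lemma mtransf_lipschitz mu (r : R) (z w : C) :
  normc z <= r -> normc w <= r -> r <= 1/2 ->
  normc ((mtransf mu z - mean mu * z) - (mtransf mu w - mean mu * w)) <=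
    24 * r * normc (z - w).
Proof.
move=> zr wr r2.
have z2 : normc z <= 1/2 by exact: le_trans r2.
have w2 : normc w <= 1/2 by exact: le_trans r2.
have cc := @ccont_cval R.
have H v : normc v <= 1/2 -> mtransf mu v - mean mu * v =
    cintegral mu (fun x => (v * cval x) ^+ 2 * (1 - v * cval x)^-1).
  move=> v2; rewrite mulrC -cintegralZ// -cintegralB//; last 2 first.
  - by apply: ccontM; [exact: ccont_zcval|exact: ccont_inv_one_sub].
  - exact: ccont_zcval.
  congr cintegral; apply/funext => x; have x0 := one_sub_neq0 x v2.
  by apply: (mulIf x0); rewrite mulrBl !divfK//; ring.
have cH v : normc v <= 1/2 ->
    ccont (fun x : circle R => (v * cval x) ^+ 2 * (1 - v * cval x)^-1).
  by move=> v2; apply: ccontM; [apply: ccontX; exact: ccont_zcval|exact: ccont_inv_one_sub].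
rewrite !H// -cintegralB//; try exact: cH.
rewrite (_ : 24 * r * _ = 2 * (12 * r * normc (z - w))); last by ring.
apply: normc_cintegral_cst => [|x]; first by apply: ccontB; exact: cH.
set p := z * cval x; set q := w * cval x.
have p0 : 1 - p != 0 := one_sub_neq0 x z2.
have q0 : 1 - q != 0 := one_sub_neq0 x w2.
have -> : p ^+ 2 * (1 - p)^-1 - q ^+ 2 * (1 - q)^-1 =
    (p - q) * ((p + q - p * q) * ((1 - p)^-1 * (1 - q)^-1)).
  by field; rewrite p0 q0.
have -> : p - q = (z - w) * cval x by rewrite mulrBl.
rewrite normcM normc_mulcval mulrC ler_wpM2r ?normc_ge0// !normcM.
have Hp : normc p <= r by rewrite normc_mulcval.
have Hq : normc q <= r by rewrite normc_mulcval.
have H1 : normc (p + q - p * q) <= 3 * r.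
  apply: le_trans (normcB _ _) _; rewrite normcM.
  have := le_normcD p q; have := normc_ge0 p; have := normc_ge0 q.
  by nra.
have H2 : normc (1 - p)^-1 <= 2 := normc_inv_one_sub x z2.
have H3 : normc (1 - q)^-1 <= 2 := normc_inv_one_sub x w2.
have := normc_ge0 (p + q - p * q).
have := normc_ge0 (1 - p)^-1; have := normc_ge0 (1 - q)^-1.
move: (normc _) H1 (normc _) H2 (normc _) H3 => a ? b ? c ? ? ? ?.
rewrite (_ : 12 * r = 3 * r * (2 * 2)); last by ring.
by apply: ler_pM => //; [exact: mulr_ge0|exact: ler_pM].
Qed.

End moments.

(** * Local surjectivity of the moment transform *)

Section local_surjectivity.
Variable R : realType.
Local Notation C := R[i].

Lemma cvg_geometric_step (u : nat -> R) (c : R) :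
  (forall n, `|u n.+1 - u n| <= c * (1/2) ^+ n) -> cvgn u.
Proof.
move=> uc.
have -> : u = cst (u 0%N) \+ series (telescope u).
  by apply/funext => n; exact: eq_sum_telescope.
apply: is_cvgD; first exact: is_cvg_cst.
apply: normed_cvg.
apply: (@series_le_cvg _ _ (geometric c (1/2))) => //.
- by move=> n; exact: normr_ge0.
- by move=> n; exact: le_trans (normr_ge0 _) (uc n).
- by apply: is_cvg_geometric_series; rewrite ger0_norm; lra.
Qed.

Lemma complex_cvg_geometric_step (s : nat -> C) (c : R) :
  (forall n, normc (s n.+1 - s n) <= c * (1/2) ^+ n) ->
  exists z, forall e, 0 < e -> \forall n \near \oo, normc (s n - z) < e.
Proof.
move=> sc.
have cRe : cvgn (fun n => complex.Re (s n)).
  apply: (@cvg_geometric_step _ c) => n; apply: le_trans (sc n).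
  by rewrite -(raddfB (@complex.Re R : Rcomplex R -> R)) normc_Re.
have cIm : cvgn (fun n => complex.Im (s n)).
  apply: (@cvg_geometric_step _ c) => n; apply: le_trans (sc n).
  by rewrite -(raddfB (@complex.Im R : Rcomplex R -> R)) normc_Im.
exists (lim ((fun n => complex.Re (s n)) @ \oo) +i*
        lim ((fun n => complex.Im (s n)) @ \oo)) => e e0.
have e20 : 0 < e / 2 by rewrite divr_gt0.
move/cvgrPdist_lt : cRe => /(_ _ e20) cRe.
move/cvgrPdist_lt : cIm => /(_ _ e20) cIm.
near=> n; apply: le_lt_trans (normc_le_ReIm _) _.
rewrite [ltRHS]splitr ltrD//.
  have : `|lim ((fun n => complex.Re (s n)) @ \oo) - complex.Re (s n)| < e / 2.
    by near: n; exact: cRe.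
  by rewrite distrC; case: (s n).
have : `|lim ((fun n => complex.Im (s n)) @ \oo) - complex.Im (s n)| < e / 2.
  by near: n; exact: cIm.
by rewrite distrC; case: (s n).
Unshelve. all: by end_near. Qed.

Lemma mtransf0 (mu : probability (circle R) R) : mtransf mu 0 = 0.
Proof.
apply/eqP; rewrite -normc_eq0 eq_le normc_ge0 andbT.
have := @mtransf_le R mu 0; rewrite normc0 mulr0; apply; lra.
Qed.

(* Banach iteration for [z = (w - (mtransf mu z - a z)) / a], [a = mean mu]. *)
Lemma mtransf_locally_onto (mu : probability (circle R) R) : nonzero_mean mu ->
  exists d K : R, [/\ 0 < d, 0 < K & forall w, normc w < d ->
    exists2 z, normc z <= K * normc w & mtransf mu z = w].
Proof.
rewrite /nonzero_mean; set a := mean mu => a0.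
have A0 : 0 < normc a by rewrite normc_gt0.
(* The Lipschitz constant [24 * r] is then at most [|a| / 2], so that after division by [a] the map
   [phi] contracts by [1/2]. *)
pose r := Num.min (1/2) (normc a / 48).
have r0 : 0 < r by rewrite lt_min; apply/andP; split; [lra|rewrite divr_gt0].
have r2 : r <= 1/2 by rewrite ge_min lexx.
have rA : 24 * r <= normc a / 2.
  have : r <= normc a / 48 by rewrite ge_min lexx orbT.
  by lra.
(* With [k = |w| / |a| = |phi 0|], the ball of radius [2 * k] is stable because
   [k + (2 * k) / 2 = 2 * k]. The first witness ensures [2 * k <= r]; the second turns [2 * k] into
   a multiple of [|w|]. *)
exists (normc a * r / 2), (2 / normc a); split; try by rewrite !(divr_gt0, mulr_gt0).
move=> w wd; pose phi z := (w - (mtransf mu z - a * z)) / a.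
have phi_lip z z' : normc z <= r -> normc z' <= r ->
    normc (phi z - phi z') <= 1/2 * normc (z - z').
  move=> zr z'r.
  have -> : phi z - phi z' =
      ((mtransf mu z' - a * z') - (mtransf mu z - a * z)) / a.
    by rewrite /phi; field.
  rewrite normcM normcV ler_pdivrMr//.
  apply: le_trans (mtransf_lipschitz mu z'r zr r2) _.
  rewrite normc_distC (mulrAC (1/2)) ler_wpM2r ?normc_ge0//; lra.
have phi0 : normc (phi 0) = normc w / normc a.
  by rewrite /phi mtransf0 mulr0 !subr0 normcM normcV.
pose k := normc w / normc a.
have kr : 2 * k <= r.
  by rewrite /k mulrA ler_pdivrMr//; lra.
have k0 : 0 <= k by rewrite divr_ge0 ?normc_ge0.
have phi_ball z : normc z <= 2 * k -> normc (phi z) <= 2 * k.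
  move=> zk; rewrite -(subrK (phi 0) (phi z)); apply: le_trans (le_normcD _ _) _.
  rewrite phi0 -/k; have := @phi_lip z 0 (le_trans zk kr); rewrite normc0 subr0.
  by move=> /(_ (ltW r0)); lra.
pose s n := iter n phi 0.
have s_ball n : normc (s n) <= 2 * k.
  by elim: n => [|n ih]; [rewrite normc0 mulr_ge0|exact: phi_ball].
have s_step n : normc (s n.+1 - s n) <= k * (1/2) ^+ n.
  elim: n => [|n ih]; first by rewrite /= subr0 phi0 expr0 mulr1.
  have := phi_lip _ _ (le_trans (s_ball n.+1) kr) (le_trans (s_ball n) kr).
  rewrite -[phi (s n.+1)]/(s n.+2) -[phi (s n)]/(s n.+1) exprS; lra.
have [z zs] := complex_cvg_geometric_step s_step.
have zk : normc z <= 2 * k.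
  apply/ler_addgt0Pr => e e0; near \oo => n.
  rewrite -(subKr (s n) z); apply: le_trans (normcB _ _) _.
  by rewrite lerD ?s_ball// ltW//; near: n; exact: zs.
have zE : phi z = z.
  apply/eqP; rewrite -subr_eq0 -normc_eq0 eq_le normc_ge0 andbT.
  apply/ler_addgt0Pr => e e0; rewrite add0r.
  have e20 : 0 < e / 2 by rewrite divr_gt0.
  near \oo => n.
  rewrite -(subrKA (s n.+1)); apply: le_trans (le_normcD _ _) _.
  have := phi_lip _ _ (le_trans zk kr) (le_trans (s_ball n) kr).
  have : normc (s n - z) < e / 2 by near: n; exact: zs.
  have : normc (s n.+1 - z) < e / 2.
    by near: n; have := zs _ e20; move=> [N _ HN]; exists N => // m Nm; apply: HN => /=; exact: leqW.
  rewrite (normc_distC z) /= => h1 h2; lra.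
exists z; first by rewrite (le_trans zk)// /k; lra.
have -> : w = phi z * a + (mtransf mu z - a * z) by rewrite /phi; field.
by rewrite zE; ring.
Unshelve. all: by end_near. Qed.

End local_surjectivity.

(** * Truncated weighted norms of polynomials *)

Section truncated_norm.
Variable R : rcfType.
Local Notation C := R[i].
Implicit Types (p q : {poly C}) (r : R).

(* Coefficients of index greater than [N] are ignored. *)
Definition nrm r N p : R := \sum_(j < N.+1) normc p`_j * r ^+ j.

Lemma nrm_ge0 r N p : 0 <= r -> 0 <= nrm r N p.
Proof. by move=> r0; apply: sumr_ge0 => j _; rewrite mulr_ge0 ?normc_ge0 ?exprn_ge0. Qed.

Lemma nrmD r N p q : 0 <= r -> nrm r N (p + q) <= nrm r N p + nrm r N q.
Proof.
move=> r0; rewrite -big_split; apply: ler_sum => j _ /=.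
by rewrite coefD -mulrDl ler_wpM2r ?exprn_ge0// le_normcD.
Qed.

Lemma nrmN r N p : nrm r N (- p) = nrm r N p.
Proof. by apply: eq_bigr => j _; rewrite coefN normcN. Qed.

Lemma nrmC r N c : nrm r N c%:P = normc c.
Proof.
rewrite /nrm big_ord_recl coefC eqxx expr0 mulr1 big1 ?addr0// => j _.
by rewrite coefC lift0 -[j.+1 == 0%N]/false normc0 mul0r.
Qed.

Lemma nrmZXn N c j : nrm 1 N (c *: 'X^j) <= normc c.
Proof.
have [jN|Nj] := ltnP j N.+1; last first.
  rewrite /nrm big1 ?normc_ge0// => i _; rewrite coefZ coefXn.
  by rewrite (ltn_eqF (leq_trans (ltn_ord i) Nj)) mulr0 normc0 mul0r.
rewrite /nrm (bigD1 (Ordinal jN))//= big1 => [|i ij]; last first.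
  have ijN : (i == j :> nat) = false by move: ij; rewrite -val_eqE => /negbTE.
  by rewrite coefZ coefXn ijN mulr0 normc0 mul0r.
by rewrite coefZ coefXn eqxx expr1n !mulr1 addr0.
Qed.

Lemma coef_le_nrm N p j : (j <= N)%N -> normc p`_j <= nrm 1 N p.
Proof.
rewrite -ltnS => jN; rewrite /nrm (bigD1 (Ordinal jN))//= expr1n mulr1 lerDl.
by apply: sumr_ge0 => i _; rewrite mulr_ge0 ?normc_ge0 ?exprn_ge0.
Qed.

Lemma nrm_le_coef N p B : (forall j, (j <= N)%N -> normc p`_j <= B) ->
  nrm 1 N p <= N.+1%:R * B.
Proof.
move=> pB; rewrite -[N.+1 in leRHS]card_ord -sum1_card natr_sum mulr_suml.
by apply: ler_sum => j _; rewrite mul1r expr1n mulr1 pB// -ltnS.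
Qed.

(** The way back from the weight [r] to the weight 1, at a cost that depends on [N] alone. *)
Lemma nrm_scale r N p : 0 < r -> r <= 1 -> r ^+ N * nrm 1 N p <= nrm r N p.
Proof.
move=> r0 r1; rewrite /nrm mulr_sumr; apply: ler_sum => j _.
rewrite expr1n mulr1 mulrC ler_wpM2l ?normc_ge0//.
by apply: ler_wiXn2l; rewrite ?(ltW r0)// -ltnS.
Qed.

(** Without a constant term every monomial carries a factor [r]; this is what absorbs a large
    constant in front of the higher coefficients. *)
Lemma nrm_scale0 r N p : 0 <= r -> r <= 1 -> p`_0 = 0 -> nrm r N p <= r * nrm 1 N p.
Proof.
move=> r0 r1 p0; rewrite /nrm mulr_sumr; apply: ler_sum => -[[|j] jN] _ /=.
  by rewrite p0 normc0 !mul0r mulr0.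
rewrite expr1n mulr1 mulrC ler_wpM2r ?normc_ge0// exprS ler_piMr//.
by rewrite exprn_ile1.
Qed.

(** The norm is the value at [r] of the truncated polynomial [P] of coefficient moduli, and
    evaluation is multiplicative. Truncation is harmless: coefficients of a product up to index [N]
    only involve coefficients up to index [N]. *)
Lemma nrmM r N p q : 0 <= r -> nrm r N (p * q) <= nrm r N p * nrm r N q.
Proof.
move=> r0; pose P s : {poly R} := \poly_(j < N.+1) normc s`_j.
have PE s : nrm r N s = (P s).[r].
  rewrite (horner_coef_wide _ (size_poly _ _)); apply: eq_bigr => j _.
  by rewrite coef_poly ltn_ord.
have P0 s j : 0 <= (P s)`_j.
  by rewrite coef_poly; case: ifP => // _; exact: normc_ge0.
rewrite !PE -hornerM -PE.
rewrite (@horner_coef_wide _ (N.+1 + size (P p * P q)%R)) ?leq_addl//.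
rewrite big_split_ord/= -[leLHS]addr0 lerD//; last first.
  by apply: sumr_ge0 => j _; rewrite coefM mulr_ge0 ?exprn_ge0// sumr_ge0// => i _;
    rewrite mulr_ge0.
apply: ler_sum => j _; rewrite ler_wpM2r ?exprn_ge0// !coefM.
apply: le_trans (normc_sum _ _ _) _; apply: ler_sum => i _.
rewrite normcM !coef_poly.
have iN : (i < N.+1)%N := leq_ltn_trans (leq_ord i) (ltn_ord j).
have jiN : (j - i < N.+1)%N := leq_ltn_trans (leq_subr _ _) (ltn_ord j).
by rewrite iN jiN.
Qed.

Lemma nrmX r N p n : 0 <= r -> nrm r N (p ^+ n) <= nrm r N p ^+ n.
Proof.
move=> r0; elim: n => [|n ih]; first by rewrite !expr0 nrmC normc1.
rewrite !exprS; apply: le_trans (nrmM _ _ _ r0) _.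
by rewrite ler_wpM2l// nrm_ge0.
Qed.

Lemma nrm_prod r N (I : Type) (s : seq I) (F : I -> {poly C}) : 0 <= r ->
  nrm r N (\prod_(i <- s) F i) <= \prod_(i <- s) nrm r N (F i).
Proof.
move=> r0; elim: s => [|i s ih]; first by rewrite !big_nil nrmC normc1.
rewrite !big_cons; apply: le_trans (nrmM _ _ _ r0) _.
by rewrite ler_wpM2l// nrm_ge0.
Qed.

Lemma coef_exp_lt p i j : p`_0 = 0 -> (j < i)%N -> (p ^+ i)`_j = 0.
Proof.
move=> p0 ji; have /dvdpP[q ->] : 'X %| p.
  by rewrite -['X]subr0 dvdp_XsubCl rootE horner_coef0 p0.
by rewrite exprMn coefMXn ji.
Qed.

Lemma coef_expnn p i : p`_0 = 0 -> (p ^+ i)`_i = p`_1 ^+ i.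
Proof.
move=> p0; have /dvdpP[q ->] : 'X %| p.
  by rewrite -['X]subr0 dvdp_XsubCl rootE horner_coef0 p0.
rewrite exprMn coefMXn ltnn subnn coefMX/=.
by rewrite -!horner_coef0 horner_exp.
Qed.

(** As [q] has no constant term, [q ^+ i] with [i > N] does not reach the coefficients that count,
    so no power of [K] beyond [K ^+ N] appears, whatever the degree of [p]. *)
Lemma nrm_comp N p q K : q`_0 = 0 -> 1 <= K -> nrm 1 N q <= K ->
  nrm 1 N (p \Po q) <= nrm 1 N p * K ^+ N.
Proof.
move=> q0 K1 qK.
have K0 : 0 <= K by exact: le_trans K1.
have -> : nrm 1 N (p \Po q) = nrm 1 N (\sum_(i < N.+1) p`_i *: q ^+ i).
  apply: eq_bigr => j _; congr (normc _ * _).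
  rewrite coef_comp_poly coef_sum.
  pose n := (N.+1 + size p)%N.
  transitivity (\sum_(i < n) p`_i * (q ^+ i)`_j).
    rewrite -(big_mkord xpredT (fun i => p`_i * (q ^+ i)`_j)).
    rewrite -(big_mkord xpredT (fun i => p`_i * (q ^+ i)`_j)).
    rewrite (@big_cat_nat _ _ _ (size p) 0 n)//= ?leq_addl//.
    rewrite [X in _ = _ + X]big_nat_cond [X in _ = _ + X]big1 ?addr0// => i /andP[/andP[pi _] _].
    by rewrite nth_default// mul0r.
  rewrite big_split_ord/= [X in _ + X]big1 ?addr0 => [|i _]; last first.
    by rewrite coef_exp_lt ?mulr0// (leq_trans (ltn_ord j))// leq_addr.
  by apply: eq_bigr => i _; rewrite coefZ.
rewrite /nrm mulr_suml -/(nrm _ _ _).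
apply: (@le_trans _ _ (\sum_(i < N.+1) nrm 1 N (p`_i *: q ^+ i))).
  elim/big_ind2 : _ => [|x1 x2 y1 y2 h1 h2|//].
    by rewrite nrmC normc0.
  by apply: le_trans (nrmD _ _ _ ler01) _; exact: lerD.
apply: ler_sum => i _; rewrite expr1n mulr1 -mul_polyC.
apply: le_trans (nrmM _ _ _ ler01) _; rewrite nrmC ler_wpM2l ?normc_ge0//.
apply: le_trans (nrmX _ _ _ ler01) _.
apply: (@le_trans _ _ (K ^+ i)); first by rewrite lerXn2r// nnegrE ?nrm_ge0.
by rewrite ler_weXn2l// -ltnS.
Qed.

(* Triangular system: the coefficient of ['X^j] in [(t \Po Phi) * M] is
   [t_j * Phi_1 ^+ j] plus a combination of the [t_i], [i < j]. *)
Lemma solve_comp N (K : R) : 1 <= K -> exists2 B : R, 0 <= B &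
  forall (Phi M D : {poly C}) (e : R), 0 <= e ->
    Phi`_0 = 0 -> M`_0 = 1 -> 1/2 <= normc Phi`_1 ->
    nrm 1 N Phi <= K -> nrm 1 N M <= K -> nrm 1 N (D - D`_0 *: M) <= K * e ->
  exists t : {poly C}, [/\ t`_0 = D`_0, nrm 1 N (t - (D`_0)%:P) <= B * e &
    forall j, (j <= N)%N -> ((t \Po Phi) * M)`_j = D`_j].
Proof.
move=> K1; have K0 : 0 <= K by exact: le_trans K1.
(* The induction is on the last solved equation [J]; the norms stay truncated at [N], so that the
   bound on [t] controls the defect in the next equation. *)
suff : forall J, (J <= N)%N -> exists2 B : R, 0 <= B &
  forall (Phi M D : {poly C}) (e : R), 0 <= e ->
    Phi`_0 = 0 -> M`_0 = 1 -> 1/2 <= normc Phi`_1 ->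
    nrm 1 N Phi <= K -> nrm 1 N M <= K -> nrm 1 N (D - D`_0 *: M) <= K * e ->
  exists t : {poly C}, [/\ t`_0 = D`_0, nrm 1 N (t - (D`_0)%:P) <= B * e &
    forall j, (j <= J)%N -> ((t \Po Phi) * M)`_j = D`_j].
  by move=> /(_ N (leqnn N)).
elim=> [_|J ih JN].
  exists 0 => // Phi M D e e0 Phi0 M0 _ _ _ _; exists (D`_0)%:P; split.
  - by rewrite coefC.
  - by rewrite subrr nrmC normc0 mul0r.
  - by move=> j; rewrite leqn0 => /eqP ->; rewrite comp_polyC mul_polyC coefZ M0 mulr1.
have [B B0 HB] := ih (ltnW JN).
(* The added term bounds the new coefficient [c]: the defect [E] is at most
   [(K + B * K ^+ N * K) * e], and dividing by [Phi_1 ^+ J.+1] costs at most [2 ^+ J.+1]. *)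
exists (B + 2 ^+ J.+1 * (K + B * K ^+ N * K)).
  by rewrite addr_ge0// mulr_ge0 ?exprn_ge0// addr_ge0// !mulr_ge0// exprn_ge0.
move=> Phi M D e e0 Phi0 M0 Phi1 PhiK MK DMK.
have [t [t0 tB tD]] := HB Phi M D e e0 Phi0 M0 Phi1 PhiK MK DMK.
have Phi1n : normc Phi`_1 != 0 by rewrite gt_eqF// (lt_le_trans _ Phi1)//; lra.
have Phi1' : Phi`_1 ^+ J.+1 != 0 by rewrite expf_neq0// -normc_eq0.
pose E := D - (t \Po Phi) * M.
pose c := E`_J.+1 / Phi`_1 ^+ J.+1.
(* Adding a multiple of [Phi ^+ J.+1 * M] leaves the equations already solved untouched. *)
have ME i : (i <= J.+1)%N -> (Phi ^+ J.+1 * M)`_i = (i == J.+1)%:R * Phi`_1 ^+ J.+1.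
  rewrite leq_eqVlt => /orP[/eqP ->|iJ].
    rewrite eqxx mul1r coefM big_ord_recr/= subnn M0 mulr1 coef_expnn//.
    rewrite big1 ?add0r// => l _; rewrite coef_exp_lt ?mul0r//=.
  rewrite (ltn_eqF iJ) mul0r coefM big1// => l _.
  by rewrite coef_exp_lt ?mul0r// (leq_ltn_trans (leq_ord l)).
exists (t + c *: 'X^(J.+1)); split.
- by rewrite coefD coefZ coefXn mulr0 addr0.
- rewrite addrAC mulrDl; apply: le_trans (nrmD _ _ _ ler01) _; apply: lerD => //.
  apply: le_trans (nrmZXn _ _ _) _.
  rewrite /c normcM normcV normcX ler_pdivrMr ?exprn_gt0 ?lt_def ?Phi1n ?normc_ge0//.
  apply: (@le_trans _ _ (nrm 1 N E)); first exact: coef_le_nrm.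
  apply: (@le_trans _ _ ((K + B * K ^+ N * K) * e)).
    have -> : E = (D - D`_0 *: M) - ((t - (D`_0)%:P) \Po Phi) * M.
      by rewrite /E rmorphB/= comp_polyC mulrBl mul_polyC; ring.
    apply: le_trans (nrmD _ _ _ ler01) _; rewrite nrmN mulrDl lerD//.
    apply: le_trans (nrmM _ _ _ ler01) _.
    rewrite (_ : B * _ * _ * _ = B * e * K ^+ N * K); last by ring.
    apply: ler_pM => //; rewrite ?nrm_ge0//.
    apply: le_trans (nrm_comp _ Phi0 K1 PhiK) _.
    by rewrite ler_wpM2r// exprn_ge0.
  rewrite [leRHS](_ : _ = (K + B * K ^+ N * K) * e *
    (2 * normc Phi`_1) ^+ J.+1); last by rewrite exprMn; ring.
  rewrite ler_peMr//; last by rewrite exprn_ege1//; lra.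
  by rewrite mulr_ge0// addr_ge0// !mulr_ge0// exprn_ge0.
- move=> j jJ; rewrite rmorphD/= mulrDl coefD linearZ/= comp_Xn_poly.
  rewrite -scalerAl coefZ ME//.
  move: jJ; rewrite leq_eqVlt => /orP[/eqP ->|jJ].
    by rewrite eqxx mul1r /c divfK// /E coefB addrC subrK.
  by rewrite (ltn_eqF jJ) mul0r mulr0 addr0 tD.
Qed.

End truncated_norm.

(** * Taylor expansions at the origin *)

Section taylor_expansion.
Variable R : realType.
Local Notation C := R[i].
Implicit Types (p q : {poly C}) (f g : C -> C).

Lemma dnbhs0P (P : C -> Prop) :
  (\forall z \near (0 : C)^', P z) <->
  exists2 d : R, 0 < d & forall z, z != 0 -> normc z < d -> P z.
Proof.
split.
  by move=> /near0P[d d0 H]; exists d => // z z0 zd; exact: (H z).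
by move=> [d d0 H]; apply/near0P; exists d => // z zd z0; exact: H.
Qed.

Lemma dnbhs0_lt (d : R) : 0 < d -> \forall z \near (0 : C)^', normc z < d.
Proof. by move=> d0; apply/dnbhs0P; exists d. Qed.

Lemma dnbhs0_neq0 : \forall z \near (0 : C)^', z != 0.
Proof. by apply/dnbhs0P; exists 1 => //. Qed.

Lemma near0_dnbhs (P : C -> Prop) :
  (\forall z \near (0 : C), P z) -> \forall z \near (0 : C)^', P z.
Proof.
by move=> /near0P[d d0 H]; apply/dnbhs0P; exists d => // z _; exact: H.
Qed.

(** Both hypotheses on [f] are used to stay in a punctured neighbourhood: the linear bound keeps
    [f z] close to 0, the second one keeps it away from 0 itself. *)
Lemma dnbhs0_comp (P : C -> Prop) f (K : R) :
  (\forall z \near (0 : C)^', normc (f z) <= K * normc z) ->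
  (\forall z \near (0 : C)^', f z != 0) ->
  (\forall z \near (0 : C)^', P z) -> \forall z \near (0 : C)^', P (f z).
Proof.
move=> fK f0 /dnbhs0P[d d0 H].
have K0 : 0 < `|K| + 1 by rewrite ltr_wpDl.
near=> z; apply: H; first by near: z.
have : normc z < d / (`|K| + 1) by near: z; apply: dnbhs0_lt; rewrite divr_gt0.
rewrite ltr_pdivlMr// mulrC; apply: le_lt_trans.
apply: (@le_trans _ _ (K * normc z)); first by near: z.
by rewrite ler_wpM2r ?normc_ge0// (le_trans (ler_norm _))// lerDl.
Unshelve. all: by end_near. Qed.

(* The neighbourhood is punctured, so that the values chosen at removable
   singularities do not matter. *)
Definition texp N f p := exists M : R,
  \forall z \near (0 : C)^', normc (f z - p.[z]) <= M * normc z ^+ N.+1.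

Lemma horner_normc_le p z : normc z <= 1 -> normc p.[z] <= \sum_(i < size p) normc p`_i.
Proof.
move=> z1; rewrite horner_coef; apply: le_trans (normc_sum _ _ _) _.
apply: ler_sum => i _; rewrite normcM normcX ler_piMr ?normc_ge0//.
by rewrite exprn_ile1// normc_ge0.
Qed.

Lemma texp_bounded N f p : texp N f p ->
  exists2 B : R, 0 <= B & \forall z \near (0 : C)^', normc (f z) <= B.
Proof.
move=> [M HM]; exists (`|M| + \sum_(i < size p) normc p`_i).
  by rewrite addr_ge0// sumr_ge0// => i _; exact: normc_ge0.
near=> z.
have z1 : normc z <= 1 by apply/ltW; near: z; exact: dnbhs0_lt.
rewrite -(subrK p.[z] (f z)); apply: le_trans (le_normcD _ _) _; apply: lerD.
  apply: (@le_trans _ _ (M * normc z ^+ N.+1)); first by near: z.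
  rewrite (le_trans (ler_norm _))// normrM ler_piMr// ger0_norm ?exprn_ge0 ?normc_ge0//.
  by rewrite exprn_ile1// normc_ge0.
exact: horner_normc_le.
Unshelve. all: by end_near. Qed.

Lemma texp_poly N p : texp N (fun z => p.[z]) p.
Proof. by exists 0; near=> z; rewrite subrr normc0 mul0r. Unshelve. all: by end_near. Qed.

Lemma texp_eq N f g p : (\forall z \near (0 : C)^', f z = g z) -> texp N f p -> texp N g p.
Proof.
move=> fg [M HM]; exists M; near=> z.
have <- : f z = g z by near: z.
by near: z.
Unshelve. all: by end_near. Qed.

Lemma texpD N f g p q : texp N f p -> texp N g q ->
  texp N (fun z => f z + g z) (p + q).
Proof.
move=> [M HM] [M' HM']; exists (M + M'); near=> z.
rewrite hornerD mulrDl opprD addrACA; apply: le_trans (le_normcD _ _) _.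
by apply: lerD; near: z.
Unshelve. all: by end_near. Qed.

Lemma texpM N f g p q : texp N f p -> texp N g q ->
  texp N (fun z => f z * g z) (p * q).
Proof.
move=> fp gq; have [B B0 fB] := texp_bounded fp.
have [B' B'0 qB] := texp_bounded (texp_poly N q).
move: fp gq => [M HM] [M' HM']; exists (B * M' + B' * M); near=> z.
have -> : f z * g z - (p * q).[z] = f z * (g z - q.[z]) + q.[z] * (f z - p.[z]).
  by rewrite hornerM; ring.
apply: le_trans (le_normcD _ _) _; rewrite !normcM mulrDl -!mulrA.
by apply: lerD; apply: ler_pM; rewrite ?normc_ge0//; near: z.
Unshelve. all: by end_near. Qed.

Lemma texp_comp_poly N p g q : texp N g q -> texp N (fun z => p.[g z]) (p \Po q).
Proof.
move=> gq; elim/poly_ind: p => [|p c ih].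
  by rewrite comp_poly0; apply: texp_eq (texp_poly N 0); near=> z; rewrite !horner0.
rewrite comp_poly_MXaddC.
apply: (@texp_eq N (fun z => p.[g z] * g z + c%:P.[z])).
  by near=> z; rewrite hornerMXaddC hornerC.
exact/texpD/texp_poly/texpM.
Unshelve. all: by end_near. Qed.

Lemma texp_comp N f p g q (K : R) : texp N f p -> texp N g q ->
  (\forall z \near (0 : C)^', normc (g z) <= K * normc z) ->
  (\forall z \near (0 : C)^', g z != 0) ->
  texp N (fun z => f (g z)) (p \Po q).
Proof.
move=> [M HM] gq gK g0; have [M' HM'] := texp_comp_poly p gq.
have HM'' := dnbhs0_comp gK g0 HM.
exists (`|M| * `|K| ^+ N.+1 + M'); near=> z.
rewrite -(subrKA p.[g z]) mulrDl; apply: le_trans (le_normcD _ _) _.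
apply: lerD; last by near: z.
apply: (@le_trans _ _ (M * normc (g z) ^+ N.+1)); first by near: z.
rewrite -mulrA -exprMn.
apply: (le_trans (ler_wpM2r (exprn_ge0 _ (normc_ge0 _)) (ler_norm M))).
rewrite ler_wpM2l//.
rewrite lerXn2r ?nnegrE ?normc_ge0 ?mulr_ge0 ?normc_ge0//.
apply: (@le_trans _ _ (K * normc z)); first by near: z.
by rewrite ler_wpM2r ?normc_ge0 ?ler_norm.
Unshelve. all: by end_near. Qed.

Lemma low_coef0_drop N p : (forall j, (j <= N)%N -> p`_j = 0) ->
  p = drop_poly N.+1 p * 'X^(N.+1).
Proof.
move=> p0; rewrite -[LHS](poly_take_drop N.+1) [take_poly _ _](_ : _ = 0) ?add0r//.
by apply/polyP => j; rewrite coef_take_poly coef0; case: ifP => // jN; rewrite p0// -ltnS.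
Qed.

Lemma texp_trunc N f p q : (forall j, (j <= N)%N -> p`_j = q`_j) ->
  texp N f p -> texp N f q.
Proof.
move=> pq [M HM].
have pqE := @low_coef0_drop N (p - q).
have {}pqE : p - q = drop_poly N.+1 (p - q) * 'X^(N.+1).
  by apply: pqE => j jN; rewrite coefB pq// subrr.
have [B B0 HB] := texp_bounded (texp_poly N (drop_poly N.+1 (p - q))).
exists (M + B); near=> z.
have -> : f z - q.[z] = (f z - p.[z]) + (p - q).[z] by rewrite hornerD hornerN; ring.
rewrite mulrDl; apply: le_trans (le_normcD _ _) _; apply: lerD; first by near: z.
rewrite pqE hornerM hornerXn normcM normcX ler_wpM2r ?exprn_ge0 ?normc_ge0//.
by near: z.
Unshelve. all: by end_near. Qed.

Lemma dnbhs0_witness (P : C -> Prop) : (\forall z \near (0 : C)^', P z) ->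
  exists2 z, z != 0 & P z.
Proof.
move=> /dnbhs0P[d d0 H].
have d2 : 0 < d / 2 by rewrite divr_gt0.
exists (d / 2)%:C; first by rewrite -normc_eq0 normc_real gt_eqF// normr_gt0 gt_eqF.
apply: H; first by rewrite -normc_eq0 normc_real gt_eqF// normr_gt0 gt_eqF.
by rewrite normc_real gtr0_norm//; lra.
Qed.

(** Letting [z] tend to 0 kills the constant term; then ['X] is divided out of both sides.
    Uniqueness of expansions follows. *)
Lemma texp_eq0 N p (M : R) :
  (\forall z \near (0 : C)^', normc p.[z] <= M * normc z ^+ N) ->
  forall j, (j < N)%N -> p`_j = 0.
Proof.
elim: N p => [//|N ih] p HM.
have p0 : p`_0 = 0.
  apply/eqP; rewrite -normc_eq0 eq_le normc_ge0 andbT; apply/ler_addgt0Pr => e e0.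
  rewrite add0r; pose q := drop_poly 1 p.
  have pE : p = (p`_0)%:P + q * 'X.
    rewrite -[LHS](poly_take_drop 1) expr1; congr (_ + _).
    by apply/polyP => -[|j]; rewrite coef_take_poly coefC.
  have [B B0 HB] := texp_bounded (texp_poly 0 q).
  pose D := `|M| + B + 1.
  have D0 : 0 < D by rewrite ltr_wpDl// addr_ge0.
  have HD := dnbhs0_lt (divr_gt0 e0 D0).
  have H1 := dnbhs0_lt (@ltr01 R).
  have [z z0 [] [] [] pz qz zD z1] := dnbhs0_witness (filterI (filterI (filterI HM HB) HD) H1).
  have -> : p`_0 = p.[z] - q.[z] * z.
    by rewrite {2}pE hornerD hornerC hornerM hornerX addrK.
  apply: le_trans (normcB _ _) _; rewrite normcM.
  apply: (@le_trans _ _ (`|M| * normc z + B * normc z)).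
    apply: lerD; last by rewrite ler_wpM2r ?normc_ge0.
    apply: (le_trans pz).
    apply: (le_trans (ler_wpM2r (exprn_ge0 _ (normc_ge0 _)) (ler_norm M))).
    rewrite ler_wpM2l// exprS ler_piMr ?normc_ge0// exprn_ile1 ?normc_ge0//.
    exact: ltW.
  rewrite -mulrDl; move: zD; rewrite ltr_pdivlMr// => zD.
  apply: le_trans (ltW zD); rewrite mulrC ler_wpM2l ?normc_ge0//.
  by rewrite /D lerDl.
have /dvdpP[q pE] : 'X %| p.
  by rewrite -['X]subr0 dvdp_XsubCl rootE horner_coef0 p0.
have qj : forall j, (j < N)%N -> q`_j = 0.
  apply: ih; near=> z.
  have z0 : 0 < normc z by rewrite normc_gt0; near: z; exact: dnbhs0_neq0.
  have : normc p.[z] <= M * normc z ^+ N.+1 by near: z.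
  by rewrite pE hornerM hornerX normcM exprSr mulrA ler_pM2r.
by case=> [//|j]; rewrite ltnS => jN; rewrite pE coefMX/= qj.
Unshelve. all: by end_near. Qed.

Lemma texp_uniq N f p q : texp N f p -> texp N f q ->
  forall j, (j <= N)%N -> p`_j = q`_j.
Proof.
move=> [M HM] [M' HM'] j jN; apply/eqP; rewrite -subr_eq0 -coefB; apply/eqP.
apply: (@texp_eq0 N.+1 _ (M + M')) jN; near=> z.
have -> : (p - q).[z] = (f z - q.[z]) - (f z - p.[z]) by rewrite hornerD hornerN; ring.
apply: le_trans (normcB _ _) _; rewrite addrC mulrDl.
by apply: lerD; near: z.
Unshelve. all: by end_near. Qed.

(** No inverse series is formed: the candidate [b] is tested after multiplication by [g], which is
    bounded below. *)
Lemma texp_div N f g b p q : texp N (fun z => f z * g z) p -> texp N g q ->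
  (\forall z \near (0 : C)^', 1/2 <= normc (g z)) ->
  (forall j, (j <= N)%N -> (b * q)`_j = p`_j) -> texp N f b.
Proof.
move=> fgp gq g2 bqp.
have {bqp} fgb : texp N (fun z => f z * g z) (b * q).
  by apply: texp_trunc fgp => j jN; rewrite bqp.
have bg : texp N (fun z => b.[z] * g z) (b * q) by apply: texpM => //; exact: texp_poly.
move: fgb bg => [M HM] [M' HM']; exists (2 * (M + M')); near=> z.
have g0 : 1/2 <= normc (g z) by near: z.
have H1 : normc (f z * g z - (b * q).[z]) <= M * normc z ^+ N.+1 by near: z.
have H2 : normc (b.[z] * g z - (b * q).[z]) <= M' * normc z ^+ N.+1 by near: z.
have : normc ((f z - b.[z]) * g z) <= (M + M') * normc z ^+ N.+1.
  have -> : (f z - b.[z]) * g z =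
    (f z * g z - (b * q).[z]) - (b.[z] * g z - (b * q).[z]) by ring.
  by apply: le_trans (normcB _ _) _; rewrite mulrDl lerD.
rewrite normcM -mulrA => H; rewrite mulrC -ler_pdivrMr//; apply: le_trans H.
by rewrite ler_wpM2l ?normc_ge0//; lra.
Unshelve. all: by end_near. Qed.

End taylor_expansion.

(** * Expansions of the transforms *)

Section transform_expansions.
Variable R : realType.
Local Notation C := R[i].
Local Notation PT := (probability (circle R) R).
Implicit Types (mu nu : PT).

(** The Taylor polynomials at 0 of [psi], [1 + psi] and [psi / z], where [psi = mtransf mu]. *)
Definition psi_poly N mu : {poly C} := \poly_(j < N.+1) (if j is 0 then 0 else moment mu j).
Definition moment_poly N mu : {poly C} := \poly_(j < N.+1) moment mu j.
Definition shift_poly N mu : {poly C} := \poly_(j < N.+1) moment mu j.+1.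

Lemma moment_polyE N mu : moment_poly N mu = 1%:P + psi_poly N mu.
Proof.
apply/polyP => j; rewrite coefD coefC !coef_poly.
by case: j => [|j] /=; rewrite ?moment0 ?addr0 ?add0r.
Qed.

Lemma dnbhs0_le (e : R) : 0 < e -> \forall z \near (0 : C)^', normc z <= e.
Proof. by move=> /(@dnbhs0_lt R); apply: filterS => z /ltW. Qed.

Lemma texp_mtransf N mu : texp N (mtransf mu) (psi_poly N mu).
Proof.
exists 4; near=> z.
have -> : (psi_poly N mu).[z] = \sum_(j < N) moment mu j.+1 * z ^+ j.+1.
  by rewrite horner_poly big_ord_recl /= mul0r add0r.
by apply: mtransf_taylor; near: z; apply: dnbhs0_le; lra.
Unshelve. all: by end_near. Qed.

Lemma texp_add1_mtransf N mu : texp N (fun z => 1 + mtransf mu z) (moment_poly N mu).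
Proof.
rewrite moment_polyE; apply: texpD; last exact: texp_mtransf.
apply: texp_eq (texp_poly N 1%:P); near=> z; by rewrite hornerC.
Unshelve. all: by end_near. Qed.

Lemma texp_mtransf_div N mu : texp N (fun z => mtransf mu z / z) (shift_poly N mu).
Proof.
exists 4; near=> z.
have z0 : z != 0 by near: z; exact: dnbhs0_neq0.
have nz0 : 0 < normc z by rewrite normc_gt0.
have : normc z <= 1/2 by near: z; apply: dnbhs0_le; lra.
move=> /(mtransf_taylor mu N.+1) H.
have -> : mtransf mu z / z - (shift_poly N mu).[z] =
    (mtransf mu z - \sum_(j < N.+1) moment mu j.+1 * z ^+ j.+1) / z.
  rewrite mulrBl; congr (_ - _); rewrite horner_poly mulr_suml.
  by apply: eq_bigr => j _; rewrite exprSr mulrA mulfK.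
by rewrite normcM normcV ler_pdivrMr// -mulrA -exprSr.
Unshelve. all: by end_near. Qed.

Lemma add1_mtransf_ge mu : \forall z \near (0 : C)^', 1/2 <= normc (1 + mtransf mu z).
Proof.
near=> z; have := normcD_ge 1 (mtransf mu z); rewrite normc1.
have z8 : normc z <= 1/8 by near: z; apply: dnbhs0_le; lra.
have := mtransf_le mu (z := z); have : normc z <= 1/2 by lra.
by move=> h /(_ h); lra.
Unshelve. all: by end_near. Qed.

Lemma add1_mtransf_neq0 mu : \forall z \near (0 : C)^', 1 + mtransf mu z != 0.
Proof.
near=> z; rewrite -normc_gt0; apply: (@lt_le_trans _ _ (1/2)); first lra.
by near: z; exact: add1_mtransf_ge.
Unshelve. all: by end_near. Qed.

Lemma Btransf_add1 mu : \forall z \near (0 : C)^',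
  Btransf mu z * (1 + mtransf mu z) = mtransf mu z / z.
Proof.
near=> z.
have z0 : z != 0 by near: z; exact: dnbhs0_neq0.
have m0 : 1 + mtransf mu z != 0 by near: z; exact: add1_mtransf_neq0.
by rewrite /Btransf (negbTE z0); field; rewrite z0 m0.
Unshelve. all: by end_near. Qed.

(** The relation [B * (1 + psi) = psi / z] between coefficients, used here to recover moments from
    an expansion of [B], and below to produce the expansion from the moments. *)
Lemma texp_Btransf_coef N mu b : texp N (Btransf mu) b ->
  forall j, (j <= N)%N -> (b * moment_poly N mu)`_j = moment mu j.+1.
Proof.
move=> Bb j jN; have := texpM Bb (texp_add1_mtransf N mu).
move=> /(texp_eq (Btransf_add1 mu)) /(texp_uniq (texp_mtransf_div N mu)) <- //.
by rewrite coef_poly ltnS jN.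
Qed.

Lemma texp_Btransf N mu b :
  (forall j, (j <= N)%N -> (b * moment_poly N mu)`_j = moment mu j.+1) ->
  texp N (Btransf mu) b.
Proof.
move=> bE; apply: (texp_div _ (texp_add1_mtransf N mu) (add1_mtransf_ge mu)).
  apply: texp_eq (texp_mtransf_div N mu).
  by move: (Btransf_add1 mu); apply: filterS => z ->.
by move=> j jN; rewrite bE// coef_poly ltnS jN.
Qed.

Lemma mtransf_bound mu : \forall z \near (0 : C)^', normc (mtransf mu z) <= 4 * normc z.
Proof. by near=> z; apply: mtransf_le; near: z; apply: dnbhs0_le; lra.
Unshelve. all: by end_near. Qed.

Lemma mtransf_neq0 mu : nonzero_mean mu -> \forall z \near (0 : C)^', mtransf mu z != 0.
Proof.
move=> a0; have A0 : 0 < normc (mean mu) by rewrite normc_gt0.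
near=> z; apply/eqP => psi0.
have z0 : 0 < normc z by rewrite normc_gt0; near: z; exact: dnbhs0_neq0.
have z2 : normc z <= 1/2 by near: z; apply: dnbhs0_le; lra.
have := mtransf_linear mu z2; rewrite psi0 sub0r normcN normcM expr2 mulrA ler_pM2r//.
have : normc z < normc (mean mu) / 4 by near: z; apply: dnbhs0_lt; rewrite divr_gt0.
by lra.
Unshelve. all: by end_near. Qed.

(** With [h z = z * (1 + psi_nu z)], the definition of [R] gives [F (h z) = psi_nu z], hence
    [G (psi_nu z) = h z]. In [H (h z) / h z] the factor [1 + psi_nu z] cancels and [B_mu z]
    remains. *)
Lemma is_cT_mtransf mu nu T : nonzero_mean nu -> is_cT mu nu T ->
  \forall z \near (0 : C)^', T (mtransf nu z) = Btransf mu z.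
Proof.
move=> nu0 [F [G [H [[_ FE] [_ _ _ _ GF] [_ HE] [_ TE]]]]].
have {}TE := dnbhs0_comp (mtransf_bound nu) (mtransf_neq0 nu0) TE.
pose h z := z * (1 + mtransf nu z).
have hb : \forall z \near (0 : C)^', normc (h z) <= 3 * normc z.
  near=> z; rewrite /h normcM mulrC ler_wpM2r ?normc_ge0//.
  apply: le_trans (le_normcD _ _) _; rewrite normc1.
  have z2 : normc z <= 1/2 by near: z; apply: dnbhs0_le; lra.
  by have := mtransf_le nu z2; lra.
have h0 : \forall z \near (0 : C)^', h z != 0.
  near=> z; rewrite /h mulf_neq0//; first by near: z; exact: dnbhs0_neq0.
  by near: z; exact: add1_mtransf_neq0.
have {}GF := dnbhs0_comp hb h0 (near0_dnbhs GF).
have {}FE := near0_dnbhs FE; have {}HE := near0_dnbhs HE.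
near=> z.
have z0 : z != 0 by near: z; exact: dnbhs0_neq0.
have mu1 : 1 + mtransf mu z != 0 by near: z; exact: add1_mtransf_neq0.
have nu1 : 1 + mtransf nu z != 0 by near: z; exact: add1_mtransf_neq0.
have -> : T (mtransf nu z) = H (G (mtransf nu z)) / G (mtransf nu z) by near: z.
have <- : F (h z) = mtransf nu z by near: z.
have -> : G (F (h z)) = h z by near: z.
have HE' : H (h z) * (1 + mtransf mu z) = mtransf mu z * (1 + mtransf nu z).
  by near: z.
apply: (mulIf mu1); rewrite mulrAC HE' /h /Btransf (negbTE z0).
by field; rewrite z0 mu1 nu1.
Unshelve. all: by end_near. Qed.

(* [T] is only known through its values at the points [mtransf nu z]; these
   fill a neighbourhood of [0]. *)
Lemma is_cT_texp N mu nu T t : nonzero_mean nu -> is_cT mu nu T ->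
  texp N (Btransf mu) (t \Po psi_poly N nu) -> texp N T t.
Proof.
move=> nu0 TT Bt; have TB := is_cT_mtransf nu0 TT.
have [M HM] := texp_comp (texp_poly N t) (texp_mtransf N nu) (mtransf_bound nu)
  (mtransf_neq0 nu0).
move: Bt => [M' HM']; have [d [K [d0 K0 onto]]] := mtransf_locally_onto nu0.
have [e e0 He] := (@dnbhs0P R _).1 (filterI TB (filterI HM HM')).
exists ((`|M| + `|M'|) * K ^+ N.+1); near=> w.
have w0 : w != 0 by near: w; exact: dnbhs0_neq0.
have wd : normc w < d by near: w; exact: dnbhs0_lt.
have [z zw psi] := onto w wd.
have z0 : z != 0.
  by apply: contraNneq w0 => z0; rewrite -psi z0 mtransf0.
have zd : normc z < e.
  apply: (le_lt_trans zw); rewrite mulrC -ltr_pdivlMr//.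
  by near: w; apply: dnbhs0_lt; rewrite divr_gt0.
have [TBz [Mz Mz']] := He z z0 zd.
rewrite -psi TBz.
have -> : Btransf mu z - t.[mtransf nu z] =
  (Btransf mu z - (t \Po psi_poly N nu).[z]) -
  (t.[mtransf nu z] - (t \Po psi_poly N nu).[z]) by ring.
apply: le_trans (normcB _ _) _; rewrite psi in Mz *.
apply: (@le_trans _ _ ((`|M| + `|M'|) * normc z ^+ N.+1)).
  rewrite [leRHS]mulrDl addrC.
  apply: lerD; apply: le_trans (ler_wpM2r (exprn_ge0 _ (normc_ge0 _)) (ler_norm _)).
    exact: Mz.
  exact: Mz'.
rewrite -mulrA -exprMn ler_wpM2l ?addr_ge0// lerXn2r// nnegrE ?normc_ge0//.
by rewrite mulr_ge0 ?normc_ge0// ltW.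
Unshelve. all: by end_near. Qed.

(** Each [B] is expanded through the [psi] of its own second component, but the [t] are expansions
    of the [cT] in one common variable, which is why they multiply. *)
Lemma cfree_conv_texp N (p1 p2 p : PT * PT) t1 t2 : cfree_conv p1 p2 p ->
  texp N (Btransf p1.1) (t1 \Po psi_poly N p1.2) ->
  texp N (Btransf p2.1) (t2 \Po psi_poly N p2.2) ->
  texp N (Btransf p.1) ((t1 * t2) \Po psi_poly N p.2).
Proof.
move=> [[nz1 nz2 nz] _ [T1 [T2 [T [cT1 cT2 cT TE]]]]] B1 B2.
have T1t := is_cT_texp nz1 cT1 B1; have T2t := is_cT_texp nz2 cT2 B2.
have Tt : texp N T (t1 * t2).
  apply: texp_eq (texpM T1t T2t).
  by move/near0_dnbhs : TE; apply: filterS => z ->.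
apply: texp_eq (is_cT_mtransf nz cT) _.
exact: texp_comp Tt (texp_mtransf N p.2) (mtransf_bound _) (mtransf_neq0 nz).
Qed.

Lemma bool_conv_texp N mu1 mu2 mu t1 t2 : bool_conv mu1 mu2 mu ->
  texp N (Btransf mu1) t1 -> texp N (Btransf mu2) t2 ->
  texp N (Btransf mu) (t1 * t2).
Proof.
move=> BE B1 B2; apply: texp_eq (texpM B1 B2); near=> z; rewrite BE//.
rewrite -[X in X < _]/((normc z)%:C) -[1]/(1%:C) ltcR.
by near: z; exact: dnbhs0_lt.
Unshelve. all: by end_near. Qed.

Lemma texp_Btransf_point_mass N (x : circle R) :
  texp N (Btransf (point_mass x)) (cval x)%:P.
Proof.
have mx j : moment (point_mass x) j = cval x ^+ j.
  rewrite /moment /cintegral /Rintegral !integral_dirac//=; last 2 first.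
  - by apply/measurable_EFinP; apply: circle_measurable; case: (@ccont_cvalX R j).
  - by apply/measurable_EFinP; apply: circle_measurable; case: (@ccont_cvalX R j).
  by rewrite !indicE !in_setT !mul1r; case: (cval x ^+ j).
apply: texp_Btransf => j jN; rewrite mul_polyC coefZ coef_poly ltnS jN.
by rewrite !mx exprS.
Qed.

Lemma psi_poly_coef0 N mu : (psi_poly N mu)`_0 = 0.
Proof. by rewrite coef_poly. Qed.

Lemma nrm_psi_poly N mu : nrm 1 N (psi_poly N mu) <= N.+1%:R * 2.
Proof.
apply: nrm_le_coef => j jN; rewrite coef_poly ltnS jN.
by case: j {jN} => [|j]; rewrite ?normc0// moment_le2.
Qed.

Lemma nrm_moment_poly N mu : nrm 1 N (moment_poly N mu) <= N.+1%:R * 2.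
Proof.
by apply: nrm_le_coef => j jN; rewrite coef_poly ltnS jN moment_le2.
Qed.

End transform_expansions.

(** * Haar measure and the Fejer kernel *)

Section haar_moments.
Variable R : realType.
Local Notation C := R[i].
Local Notation PT := (probability (circle R) R).

Lemma cisX (t : R) j : cval (cis t) ^+ j = cos (j%:R * t) +i* sin (j%:R * t).
Proof.
elim: j => [|j ih]; first by rewrite expr0 mul0r cos0 sin0.
rewrite exprS ih /cval /= -natr1 mulrDl mul1r cosD sinD; simpc.
by congr (_ +i* _); ring.
Qed.

(** The two pushforward formulas are applied to nonnegative integrands; the moments fit this form
    once 1 is added to each component. *)
Lemma haar_integral_FTC (u : circle R -> R) (F : R -> R) : continuous u ->
  (forall x, 0 <= u x) -> (forall t : R, is_derive t (1 : R) F (u (cis t))) ->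
  \int[haar R]_x u x = (2 * pi)^-1 * (F (2 * pi) - F 0).
Proof.
move=> cu u0 dF; rewrite /Rintegral ge0_integral_distribution; last 2 first.
- by apply/measurable_EFinP; exact: circle_measurable.
- by move=> x; rewrite lee_fin.
have cuc : continuous (u \o @cis R).
  by move=> t; apply: continuous_comp; [exact: cis_continuous|exact: cu].
rewrite integral_uniform//=; last 2 first.
- by apply/measurable_EFinP; exact: continuous_measurable_fun cuc.
- by move=> t; rewrite lee_fin.
have pi20 : 0 < 2 * pi :> R by rewrite mulr_gt0// pi_gt0.
rewrite subr0 (@continuous_FTC2 _ (u \o @cis R) F)//.
- exact: continuous_subspaceT.
- have cF t : {for t, continuous F}.
    by apply: differentiable_continuous; apply/derivable1_diffP; case: (dF t).
  split; first by move=> t _; case: (dF t).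
    exact/cvg_at_right_filter/cF.
  exact/cvg_at_left_filter/cF.
- by move=> t _; rewrite derive1E; case: (dF t).
Qed.

Lemma is_derive_sin_lin (c t : R) : c != 0 ->
  is_derive t (1 : R) (fun t => t + c^-1 * sin (c * t)) (1 + cos (c * t)).
Proof.
move=> c0.
have dl : is_derive t (1 : R) (fun t : R => c * t) c.
  have := @is_deriveZ R _ _ id c t 1 1 (is_derive_id _ _).
  by rewrite /GRing.scale/= mulr1.
have ds : is_derive t (1 : R) (fun t => sin (c * t)) (cos (c * t) * c).
  exact: (is_derive1_comp (is_derive_sin (c * t)) dl).
apply: (is_derive_eq (is_deriveD (is_derive_id t 1) (is_deriveZ c^-1 ds))).
by rewrite /GRing.scale/= mulrCA mulVf ?mulr1.
Qed.
Lemma is_derive_cos_lin (c t : R) : c != 0 ->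
  is_derive t (1 : R) (fun t => t - c^-1 * cos (c * t)) (1 + sin (c * t)).
Proof.
move=> c0.
have dl : is_derive t (1 : R) (fun t : R => c * t) c.
  have := @is_deriveZ R _ _ id c t 1 1 (is_derive_id _ _).
  by rewrite /GRing.scale/= mulr1.
have ds : is_derive t (1 : R) (fun t => cos (c * t)) (- sin (c * t) * c).
  exact: (is_derive1_comp (is_derive_cos (c * t)) dl).
apply: (is_derive_eq (is_deriveB (is_derive_id t 1) (is_deriveZ c^-1 ds))).
by rewrite /GRing.scale/= mulrCA mulVf ?mulr1// opprK.
Qed.

Lemma haar_moment j : moment (haar R) j.+1 = 0.
Proof.
set c : R := j.+1%:R.
have c0 : c != 0 by rewrite pnatr_eq0.
have [rc ic] := @ccont_cvalX R j.+1.
have c1 := @rcont_cst R 1.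
have cis2pi : cval (cis (2 * pi : R)) = 1.
  by rewrite -[LHS]/(cos (2 * pi) +i* sin (2 * pi)) mulr_natl cos2pi sin2pi.
(* The boundary values of [cos] and [sin] at [c * (2 * pi)] come from raising [cis (2 * pi) = 1] to
   the power [j.+1]. *)
have := cisX (2 * pi) j.+1; rewrite cis2pi expr1n => -[/esym cos1 /esym sin1].
have bound (x : circle R) : normc (cval x ^+ j.+1) <= 1.
  by rewrite normcX normc_cval expr1n.
have pi0 : (2 * pi : R) != 0 by rewrite gt_eqF// mulr_gt0// pi_gt0.
have HRe : \int[haar R]_x (1 + complex.Re (cval x ^+ j.+1)) = 1.
  have dF (t : R) : is_derive t (1 : R) (fun t => t + c^-1 * sin (c * t))
      (1 + complex.Re (cval (cis t) ^+ j.+1)).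
    by rewrite cisX; exact: is_derive_sin_lin.
  rewrite (haar_integral_FTC (rcontD c1 rc) _ dF) => [|x].
    by rewrite mulr0 sin0 sin1 !mulr0 !addr0 subr0 mulVf.
  by have := le_trans (normc_Re _) (bound x); rewrite ler_norml; lra.
have HIm : \int[haar R]_x (1 + complex.Im (cval x ^+ j.+1)) = 1.
  have dF (t : R) : is_derive t (1 : R) (fun t => t - c^-1 * cos (c * t))
      (1 + complex.Im (cval (cis t) ^+ j.+1)).
    by rewrite cisX; exact: is_derive_cos_lin.
  rewrite (haar_integral_FTC (rcontD c1 ic) _ dF) => [|x].
    by rewrite mulr0 cos0 cos1 !mulr1 sub0r opprK subrK mulVf.
  by have := le_trans (normc_Im _) (bound x); rewrite ler_norml; lra.
have one : \int[haar R]_x (1 : R) = 1.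
  by rewrite Rintegral_cst// [X in fine X](_ : _ = 1%E) ?mulr1//; exact: probability_setT.
rewrite /moment /cintegral; congr (_ +i* _).
  move: HRe; rewrite RintegralD//; try exact: circle_integrable.
  by rewrite one => /(canRL (addKr _)); rewrite addrC subrr.
move: HIm; rewrite RintegralD//; try exact: circle_integrable.
by rewrite one => /(canRL (addKr _)); rewrite addrC subrr.
Qed.

End haar_moments.

(** * Weak convergence to Haar measure from moments *)

Section fejer.
Variable R : realType.
Local Notation C := R[i].
Local Notation PT := (probability (circle R) R).
Implicit Types (mu : PT) (x y : circle R).

(** The Fourier coefficient of index [j - l]; two natural exponents cover negative frequencies, the
    conjugate being the inverse on the circle. *)
Definition tmoment mu j l : C := cintegral mu (fun x => cval x ^+ j * (cval x ^+ l)^*).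

Lemma cval_conj x : cval x * (cval x)^* = 1.
Proof. by rewrite normc_conjM normc_cval expr1n. Qed.

Lemma tmomentD mu j l : tmoment mu (l + j) l = moment mu j.
Proof.
rewrite /tmoment; congr cintegral; apply/funext => x.
by rewrite rmorphXn/= exprD mulrAC -exprMn cval_conj expr1n mul1r.
Qed.

Lemma tmomentC mu j l : tmoment mu j l = (tmoment mu l j)^*.
Proof.
rewrite /tmoment -cintegral_conj; last first.
  by apply: ccontM; [|apply: ccont_conj]; exact: ccont_cvalX.
by congr cintegral; apply/funext => x; rewrite rmorphM/= conjcK mulrC.
Qed.

Lemma tmoment_diag mu j : tmoment mu j j = 1.
Proof. by rewrite -[j in X in tmoment _ X _]addn0 tmomentD moment0. Qed.

Lemma normc_tmoment mu j l : normc (tmoment mu j l) = normc (moment mu `|j - l|).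
Proof.
wlog lj : j l / (l <= j)%N => [H|].
  have [/H//|/ltnW jl] := leqP l j.
  by rewrite tmomentC normc_conj distnC H.
by rewrite distnEl// -{1}(subnKC lj) tmomentD.
Qed.

Lemma ccont_tmon j l : ccont (fun x : circle R => cval x ^+ j * (cval x ^+ l)^*).
Proof. by apply: ccontM; [|apply: ccont_conj]; exact: ccont_cvalX. Qed.

Definition dirichlet n x y : C := \sum_(j < n.+1) cval x ^+ j * (cval y ^+ j)^*.

(* [normc (dirichlet n x y) ^+ 2 / n.+1] is the Fejer kernel at [x / y]. *)
Definition fejer n x y : R := normc (dirichlet n x y) ^+ 2 / n.+1%:R.

Lemma dirichlet_le n x y : normc (cval x - cval y) * normc (dirichlet n x y) <= 2.
Proof.
have -> : normc (cval x - cval y) = normc (1 - cval x * (cval y)^*).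
  rewrite -[LHS]mulr1 -(normc_cval y) -(normc_conj (cval y)) -normcM mulrBl.
  by rewrite cval_conj normc_distC.
rewrite -normcM; set w := cval x * (cval y)^*.
have -> : dirichlet n x y = \sum_(j < n.+1) 1 ^+ (n.+1.-1 - j) * w ^+ j.
  by apply: eq_bigr => j _; rewrite expr1n mul1r rmorphXn/= -exprMn.
rewrite -subrXX expr1n (le_trans (normcB _ _))// normc1 normcX /w normcM normc_conj.
by rewrite !normc_cval mul1r expr1n.
Qed.

Lemma fejer_ge0 n x y : 0 <= fejer n x y.
Proof. by rewrite divr_ge0// sqr_ge0. Qed.

Lemma fejer_tail n x y (d : R) : 0 < d -> d <= normc (cval x - cval y) ->
  fejer n x y <= (2 / d) ^+ 2 / n.+1%:R.
Proof.
move=> d0 dxy; rewrite /fejer ler_wpM2r// lerXn2r ?nnegrE ?normc_ge0//.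
  by rewrite divr_ge0// ltW.
rewrite ler_pdivlMr// mulrC; apply: le_trans (dirichlet_le n x y).
by rewrite ler_wpM2r// normc_ge0.
Qed.

Lemma fejerE n x y : (fejer n x y)%:C =
  n.+1%:R^-1 * \sum_(j < n.+1) \sum_(l < n.+1)
    (cval x ^+ j * (cval x ^+ l)^*) * (cval y ^+ l * (cval y ^+ j)^*).
Proof.
rewrite /fejer rmorphM/= -normc_conjM fmorphV/= rmorph_nat mulrC; congr (_ * _).
rewrite /dirichlet rmorph_sum mulr_suml; apply: eq_bigr => j _.
rewrite mulr_sumr; apply: eq_bigr => l _.
rewrite -[X in _ * X = _]/((cval x ^+ l * (cval y ^+ l)^*)^*) rmorphM/= conjcK.
ring.
Qed.

Lemma ccont_fejer_term (f : circle R -> C) x n : ccont f ->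
  forall j : 'I_n.+1, ccont (fun y => \sum_(l < n.+1)
    (cval x ^+ j * (cval x ^+ l)^*) * (f y * (cval y ^+ l * (cval y ^+ j)^*))).
Proof.
move=> cf j; apply: ccont_sum => l; apply: ccontM; first exact: ccont_cst.
by apply: ccontM => //; exact: ccont_tmon.
Qed.

Lemma cintegral_fejer mu (f : circle R -> C) n x : ccont f ->
  cintegral mu (fun y => f y * (fejer n x y)%:C) =
  n.+1%:R^-1 * \sum_(j < n.+1) \sum_(l < n.+1)
    (cval x ^+ j * (cval x ^+ l)^*) *
    cintegral mu (fun y => f y * (cval y ^+ l * (cval y ^+ j)^*)).
Proof.
move=> cf; have cft := ccont_fejer_term x cf.
have cfm l j : ccont (fun y => f y * (cval y ^+ l * (cval y ^+ j)^*)).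
  by apply: ccontM => //; exact: ccont_tmon.
under eq_fun => y do rewrite fejerE mulrCA mulr_sumr.
under eq_fun => y do under eq_bigr => j _ do rewrite mulr_sumr.
under eq_fun => y do under eq_bigr => j _ do under eq_bigr => l _ do rewrite mulrCA.
rewrite cintegralZ; last exact: ccont_sum.
congr (_ * _); rewrite cintegral_sum//; apply: eq_bigr => j _.
rewrite cintegral_sum => [|l]; last by apply: ccontM => //; exact: ccont_cst.
by apply: eq_bigr => l _; rewrite cintegralZ.
Qed.

Lemma tmoment_haar j l : tmoment (haar R) j l = (j == l)%:R.
Proof.
have [->|jl] := eqVneq j l; first by rewrite tmoment_diag.
apply/eqP; rewrite -normc_eq0 normc_tmoment.
have := distn_eq0 j l; rewrite (negbTE jl).
by case: (`|j - l|)%N => // k _; rewrite haar_moment normc0.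
Qed.

Lemma cintegral_fejer1 n x : cintegral (haar R) (fun y => (fejer n x y)%:C) = 1.
Proof.
have := @cintegral_fejer (haar R) (fun=> 1) n x (@ccont_cst R 1).
under eq_fun do rewrite mul1r; move=> ->.
rewrite (eq_bigr (fun=> 1)) => [|j _].
  by rewrite sumr_const card_ord mulVf// pnatr_eq0.
under eq_bigr do under eq_fun do rewrite mul1r.
rewrite (bigD1 j)//= big1 => [|l lj].
  by rewrite -/(tmoment _ _ _) tmoment_diag mulr1 -/(tmoment _ _ _) addr0
    normc_conjM normcX normc_cval !expr1n.
by rewrite -/(tmoment _ _ _) tmoment_haar val_eqE (negbTE lj) mulr0.
Qed.

Lemma fejer_continuous n x : continuous (fejer n x).
Proof.
have cD : ccont (dirichlet n x).
  apply: ccont_sum => j; apply: ccontM; first exact: ccont_cst.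
  exact/ccont_conj/ccont_cvalX.
apply: rcontM; last exact: rcont_cst.
by apply: rcontM; exact: normc_continuous.
Qed.

(** For [y] near [x] the modulus of continuity meets the total mass 1 of the kernel; elsewhere
    [|f y - f x| <= 2 * M] meets [fejer_tail], which is [O(1 / n)]. Each part is at most [e / 4],
    and the integral estimate doubles the sum. *)
Lemma fejer_approx (f : circle R -> R) (e : R) : continuous f -> 0 < e ->
  exists n, forall x, normc (cintegral (haar R) (fun y => (f y)%:C * (fejer n x y)%:C)
    - (f x)%:C) <= e.
Proof.
move=> cf e0; have [M HM] := circle_bounded cf.
have M0 : 0 <= M by exact: le_trans (normr_ge0 _) (HM point).
have e4 : 0 < e / 4 by rewrite divr_gt0.
have [d d0 Hd] := circle_unif_continuous cf e4.
pose K := 2 * M * (2 / d) ^+ 2.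
have K0 : 0 <= K by apply: mulr_ge0; [exact: mulr_ge0|exact: sqr_ge0].
exists (Num.truncn (K / (e / 4))) => x; set n := Num.truncn _.
have nK : K / n.+1%:R <= e / 4.
  rewrite ler_pdivrMr// mulrC -ler_pdivrMr//; apply/ltW.
  by rewrite /n truncnS_gt// divr_ge0// ltW.
have cfe : ccont (fun y => (fejer n x y)%:C) by exact/ccont_real/fejer_continuous.
have -> : cintegral (haar R) (fun y => (f y)%:C * (fejer n x y)%:C) - (f x)%:C =
    cintegral (haar R) (fun y => ((f y - f x) * fejer n x y)%:C).
  rewrite -[X in _ - X]mulr1 -(cintegral_fejer1 n x) -cintegralZ// -cintegralB.
  - by congr cintegral; apply/funext => y; rewrite !rmorphM/= rmorphB/= mulrBl.
  - by apply: ccontM => //; exact: ccont_real.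
  - by apply: ccontM => //; exact: ccont_cst.
pose u y := e / 4 * fejer n x y + K / n.+1%:R.
have cu1 : continuous (fun y => e / 4 * fejer n x y).
  by apply: rcontM; [exact: rcont_cst|exact: fejer_continuous].
have cu : continuous u by apply: rcontD => //; exact: rcont_cst.
have cfx : continuous (fun y => f y - f x).
  by apply: rcontD => //; exact: rcont_cst.
apply: le_trans (normc_cintegral (haar R) _ cu _) _.
- by apply: ccont_real; apply: rcontM => //; exact: fejer_continuous.
- move=> y; rewrite normc_real normrM (ger0_norm (fejer_ge0 _ _ _)) /u.
  have [yx|yx] := ltP (normc (cval y - cval x)) d.
    rewrite -[leLHS]addr0 lerD// ?divr_ge0// ler_wpM2r ?fejer_ge0//.
    exact/ltW/Hd.
  rewrite -[leLHS]add0r lerD//; first by rewrite mulr_ge0 ?fejer_ge0// ltW.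
  rewrite /K -mulrA ler_pM ?fejer_ge0//.
    rewrite (le_trans (ler_normB _ _))//; have := HM x; have := HM y; lra.
  by apply: fejer_tail => //; rewrite normc_distC.
rewrite RintegralD//; try exact: circle_integrable.
  rewrite RintegralZl//; last exact/circle_integrable/fejer_continuous.
  have := cintegral_fejer1 n x; rewrite cintegral_real => -[->].
  rewrite Rintegral_cst// [X in fine X](_ : _ = 1%E) ?mulr1; last exact: probability_setT.
  by move: nK; move: (K / n.+1%:R) => X; lra.
exact/circle_integrable/rcont_cst.
Qed.

Lemma cvg_sum0 (I : Type) (s : seq I) (P : pred I) (F : I -> nat -> R) :
  (forall i, P i -> F i @ \oo --> 0) ->
  (fun n => \sum_(i <- s | P i) F i n) @ \oo --> 0.
Proof.
move=> F0; elim: s => [|i s ih].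
  by under eq_fun do rewrite big_nil; exact: cvg_cst.
have [Pi|nPi] := boolP (P i); last first.
  by under eq_fun do rewrite big_cons (negbTE nPi).
under eq_fun do rewrite big_cons Pi.
by have := cvgD (F0 i Pi) ih; rewrite addr0; exact.
Qed.

Lemma cvgZ0 (c : R) (u : nat -> R) : u @ \oo --> 0 -> (fun n => c * u n) @ \oo --> 0.
Proof. by move=> u0; have := cvgM (cvg_cst c) u0; rewrite mulr0; exact. Qed.

(** The Fejer mean [g] of [f] is a trigonometric polynomial. Its diagonal terms have the same
    integral under every probability measure and cancel in [gdiff]; the others tend to 0. The budget
    is [e / 4] for each replacement of [f] by [g] and [e / 2] for [g]. *)
Lemma weak_cvg_haar (mu_ : nat -> PT) :
  (forall j, (fun n => normc (moment (mu_ n) j.+1)) @ \oo --> 0) ->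
  weak_cvg mu_ (haar R).
Proof.
move=> mom f cf; apply/cvgrPdist_le => e e0.
have e8 : 0 < e / 8 by rewrite divr_gt0.
have [N HN] := fejer_approx cf e8.
have [M HM] := circle_bounded cf.
have M0 : 0 <= M by exact: le_trans (normr_ge0 _) (HM point).
have cfc := ccont_real cf.
pose c (j l : nat) := cintegral (haar R) (fun y => (f y)%:C * (cval y ^+ l * (cval y ^+ j)^*)).
pose g x := cintegral (haar R) (fun y => (f y)%:C * (fejer N x y)%:C).
have gE : g = fun x => N.+1%:R^-1 * \sum_(j < N.+1) \sum_(l < N.+1)
    c j l * (cval x ^+ j * (cval x ^+ l)^*).
  apply/funext => x; rewrite /g cintegral_fejer//; congr (_ * _).
  by apply: eq_bigr => j _; apply: eq_bigr => l _; rewrite mulrC.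
have cterm j l : ccont (fun x => c j l * (cval x ^+ j * (cval x ^+ l)^*)).
  by apply: ccontM; [exact: ccont_cst|exact: ccont_tmon].
have crow (j : nat) : ccont (fun x => \sum_(l < N.+1) c j l * (cval x ^+ j * (cval x ^+ l)^*)).
  by apply: ccont_sum => l.
have cg : ccont g.
  by rewrite gE; apply: ccontM; [exact: ccont_cst|apply: ccont_sum => j].
have gint mu : cintegral mu g = N.+1%:R^-1 * \sum_(j < N.+1) \sum_(l < N.+1)
    c j l * tmoment mu j l.
  rewrite gE cintegralZ; last by apply: ccont_sum => j.
  congr (_ * _); rewrite cintegral_sum => [|j//]; apply: eq_bigr => j _.
  by rewrite cintegral_sum => [|l//]; apply: eq_bigr => l _; rewrite cintegralZ//; exact: ccont_tmon.
have gdiff mu : cintegral mu g - cintegral (haar R) g =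
    N.+1%:R^-1 * \sum_(j < N.+1) \sum_(l < N.+1 | l != j) c j l * tmoment mu j l.
  rewrite !gint -mulrBr -sumrB; congr (_ * _); apply: eq_bigr => j _.
  rewrite (bigD1 j)//= [X in _ - X](bigD1 j)//= [X in _ - (_ + X)]big1 => [|l lj].
    by rewrite !tmoment_diag addr0 addrAC subrr add0r.
  by rewrite tmoment_haar eq_sym val_eqE (negbTE lj) mulr0.
have approx mu : normc (cintegral mu g - cintegral mu (fun x => (f x)%:C)) <= e / 4.
  rewrite -cintegralB// (_ : e / 4 = 2 * (e / 8)); last by field.
  by apply: normc_cintegral_cst => [|x]; [exact: ccontB|exact: HN].
pose D n := N.+1%:R^-1 * \sum_(j < N.+1) \sum_(l < N.+1 | l != j)
    normc (c j l) * normc (moment (mu_ n) `|j - l|).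
have D0 : D @ \oo --> 0.
  apply: cvgZ0; apply: cvg_sum0 => j _; apply: cvg_sum0 => l lj; apply: cvgZ0.
  have jl : (j == l :> nat) = false by rewrite eq_sym; exact/negbTE.
  have := distn_eq0 j l; rewrite jl.
  by case: (`|j - l|)%N => // k _; exact: mom.
have e2 : 0 < e / 2 by rewrite divr_gt0.
move/cvgrPdist_le : D0 => /(_ _ e2); apply: filterS => n; rewrite sub0r normrN => Dn.
rewrite -normc_real rmorphB -[X in normc (X - _)]cintegral_real.
rewrite -[X in normc (_ - X)]cintegral_real.
have H1 := approx (mu_ n); have H2 := approx (haar R).
have H3 : normc (cintegral (mu_ n) g - cintegral (haar R) g) <= e / 2.
  apply: le_trans (le_trans (ler_norm _) Dn); rewrite gdiff normcM /D.
  rewrite normcV -(rmorph_nat (real_complex R)) normc_real ger0_norm// ler_wpM2l//.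
  apply: le_trans (normc_sum _ _ _) _; apply: ler_sum => j _.
  apply: le_trans (normc_sum _ _ _) _; apply: ler_sum => l _.
  by rewrite normcM normc_tmoment.
set I := cintegral (haar R) (fun x => (f x)%:C) in H2 *.
set J := cintegral (mu_ n) (fun x => (f x)%:C) in H1 *.
have -> : I - J = - (cintegral (haar R) g - I) - (cintegral (mu_ n) g - cintegral (haar R) g)
    + (cintegral (mu_ n) g - J) by ring.
apply: le_trans (le_normcD _ _) _; apply: le_trans (lerD (normcB _ _) (lexx _)) _.
by rewrite normcN; lra.
Qed.

Lemma weak_cvg_mean (mu_ : nat -> PT) : weak_cvg mu_ (haar R) ->
  (fun n => normc (mean (mu_ n))) @ \oo --> 0.
Proof.
move=> cv; have [rc ic] := @ccont_cval R.
have := haar_moment R 0; rewrite moment1 => -[hr hi].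
have := cv _ rc; rewrite hr => /cvg_norm; rewrite normr0 => cr.
have := cv _ ic; rewrite hi => /cvg_norm; rewrite normr0 => ci.
have := cvgD cr ci; rewrite addr0 => H.
suff B : \forall n \near \oo, 0 <= normc (mean (mu_ n)) <=
    `|\int[mu_ n]_x complex.Re (cval x)| + `|\int[mu_ n]_x complex.Im (cval x)|.
  exact: (squeeze_cvgr B (cvg_cst 0) (H _)).
by near=> n; rewrite normc_ge0; exact: (normc_le_ReIm (mean (mu_ n))).
Unshelve. all: by end_near. Qed.

End fejer.

(** * The criterion *)

Section main.
Variable R : realType.
Local Notation C := R[i].
Local Notation PT := (probability (circle R) R).
Implicit Types (mu nu : PT) (t Phi : {poly C}).

(** A general [Phi] serves both convolutions: [psi_poly] for the c-free one, ['X] for the boolean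
    one. In the triangular system the defect has coefficients [m_(j+1) - a * m_j], which
    [moment_drift] makes linear in [1 - |a|]. *)
Lemma exists_T_poly N (K : R) : 1 <= K -> exists2 B : R, 0 <= B &
  forall mu Phi, Phi`_0 = 0 -> 1/2 <= normc Phi`_1 -> nrm 1 N Phi <= K ->
  exists t, [/\ t`_0 = mean mu,
    nrm 1 N (t - (t`_0)%:P) <= B * (1 - normc t`_0) &
    texp N (Btransf mu) (t \Po Phi)].
Proof.
(* [K'] has to dominate [K], the norm [2 * N.+1] of the moment polynomial, and the constant
   [4 * N * N.+1] of the drift. *)
move=> K1; pose K' := K + 4 * N.+1%:R ^+ 2.
have N1 : 1 <= N.+1%:R :> R by rewrite ler1n.
have K'1 : 1 <= K' by rewrite /K'; nra.
have [B B0 HB] := solve_comp N K'1; exists B => // mu Phi Phi0 Phi1 PhiK.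
have e0 : 0 <= 1 - normc (mean mu) by rewrite subr_ge0 normc_mean_le1.
have D0 : (shift_poly N mu)`_0 = mean mu by rewrite coef_poly.
have [||||t [t0 tB tD]] := HB Phi (moment_poly N mu) (shift_poly N mu) _ e0 Phi0 _ Phi1.
- by rewrite coef_poly moment0.
- by rewrite (le_trans PhiK)// /K' lerDl mulr_ge0// sqr_ge0.
- by apply: le_trans (nrm_moment_poly N mu) _; rewrite /K'; nra.
- have H : nrm 1 N (shift_poly N mu - (shift_poly N mu)`_0 *: moment_poly N mu) <=
      N.+1%:R * (4 * N%:R * (1 - normc (mean mu))).
    apply: nrm_le_coef => j jN; rewrite D0 coefB coefZ !coef_poly ltnS jN.
    apply: (le_trans (moment_drift _ _)); rewrite ler_wpM2r// ler_wpM2l//.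
    by rewrite ler_nat.
  apply: (le_trans H); rewrite !mulrA ler_wpM2r// /K' -natr1.
  by have := ler0n R N; move: (N%:R : R) => n n0; nra.
exists t; rewrite t0 D0 in tB *; split => //.
by apply: texp_Btransf => j jN; rewrite tD// coef_poly ltnS jN.
Qed.

(* Only the weight [r] has to be small: [nrm r N t <= 1 - (1 - |t_0|) / 2], whose
   cube is at most [|t_0|]. *)
Lemma nrm_prod_decay N (B : R) : 0 <= B -> exists2 Q : R, 0 <= Q &
  forall (I : Type) (s : seq I) (t : I -> {poly C}),
  (forall i, 1/2 <= normc (t i)`_0 <= 1) ->
  (forall i, nrm 1 N (t i - ((t i)`_0)%:P) <= B * (1 - normc (t i)`_0)) ->
  nrm 1 N (\prod_(i <- s) t i) ^+ 3 <= Q * \prod_(i <- s) normc (t i)`_0.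
Proof.
(* Chosen so that [r * B <= 1/2]: the higher coefficients then use up only half of the gap
   [1 - |t_0|]. *)
move=> B0; pose r := (2 * B + 2)^-1.
have rp : 0 < 2 * B + 2 by lra.
have r0 : 0 < r by rewrite invr_gt0.
have r1 : r <= 1 by rewrite invf_le1//; lra.
have rB : r * B <= 1/2 by rewrite /r mulrC ler_pdivrMr//; lra.
exists ((r ^- N) ^+ 3); first by rewrite exprn_ge0// invr_ge0 exprn_ge0// ltW.
move=> I s t t0 tB.
have H1 : nrm 1 N (\prod_(i <- s) t i) <= r ^- N * nrm r N (\prod_(i <- s) t i).
  rewrite ler_pdivlMl ?exprn_gt0//; exact: nrm_scale.
apply: (@le_trans _ _ ((r ^- N * nrm r N (\prod_(i <- s) t i)) ^+ 3)).
  rewrite lerXn2r ?nnegrE ?nrm_ge0// mulr_ge0 ?nrm_ge0 ?(ltW r0)//.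
  by rewrite invr_ge0 exprn_ge0// ltW.
rewrite exprMn ler_wpM2l//; first by rewrite exprn_ge0// invr_ge0 exprn_ge0// ltW.
apply: (@le_trans _ _ ((\prod_(i <- s) nrm r N (t i)) ^+ 3)).
  rewrite lerXn2r ?nnegrE ?nrm_ge0 ?(ltW r0)//.
    by apply: prodr_ge0 => i _; rewrite nrm_ge0// ltW.
  by apply: nrm_prod; exact: ltW.
rewrite -prodrXl; apply: ler_prod => i _.
rewrite exprn_ge0 ?nrm_ge0 ?(ltW r0)//=.
have /andP[a2 a1] := t0 i; set a := normc _ in a1 a2 *.
have H : nrm r N (t i) <= 1 - (1 - a) / 2.
  have -> : nrm r N (t i) = nrm r N ((t i - ((t i)`_0)%:P) + ((t i)`_0)%:P).
    by rewrite subrK.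
  apply: (le_trans (nrmD _ _ _ (ltW r0))); rewrite nrmC -/a.
  have h1 : nrm r N (t i - ((t i)`_0)%:P) <= r * nrm 1 N (t i - ((t i)`_0)%:P).
    by apply: nrm_scale0; rewrite ?(ltW r0)// coefB coefC subrr.
  have h2 := ler_wpM2l (ltW r0) (tB i); rewrite -/a mulrA in h2.
  have h3 : r * B * (1 - a) <= 1/2 * (1 - a) by rewrite ler_wpM2r// subr_ge0.
  lra.
apply: (@le_trans _ _ ((1 - (1 - a) / 2) ^+ 3)).
  by rewrite lerXn2r ?nnegrE ?nrm_ge0 ?(ltW r0)//; lra.
(* With [s = 1 - a <= 1/2] this is [(1 - s / 2) ^ 3 <= 1 - s]. A square would not do, as
   [(1 - s / 2) ^ 2 = 1 - s + s ^ 2 / 4]. *)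
rewrite !exprS expr0; nra.
Qed.

(** Moments are coefficients of [(t \Po Phi) * moment_poly N mu]; all smallness sits in [t], so
    crude bounds on the other factors suffice. *)
Lemma moment_le_nrm N (K : R) mu t Phi : 1 <= K -> Phi`_0 = 0 -> nrm 1 N Phi <= K ->
  texp N (Btransf mu) (t \Po Phi) -> forall j, (j <= N)%N ->
  normc (moment mu j.+1) <= nrm 1 N t * (K ^+ N * (N.+1%:R * 2)).
Proof.
move=> K1 Phi0 PhiK Bt j jN; rewrite -(texp_Btransf_coef Bt jN).
apply: le_trans (coef_le_nrm _ jN) _; apply: le_trans (nrmM _ _ _ ler01) _.
rewrite (mulrA (nrm 1 N t)); apply: ler_pM; try exact: nrm_ge0 ler01.
  exact: nrm_comp.
exact: nrm_moment_poly.
Qed.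

Lemma mean_texp N mu t Phi : Phi`_0 = 0 -> texp N (Btransf mu) (t \Po Phi) ->
  mean mu = t`_0.
Proof.
move=> Phi0 Bt; have := texp_Btransf_coef Bt (leq0n N).
rewrite coefM big_ord1 subnn [X in _ * X]coef_poly/= moment0 mulr1 moment1 => <-.
by rewrite -[LHS]horner_coef0 horner_comp [Phi.[0]]horner_coef0 Phi0 horner_coef0.
Qed.

Lemma measurable_far_from1 (e : R) :
  measurable [set x : circle R | e%:C <= `|cval x - 1|].
Proof.
have cu : continuous (fun x : circle R => normc (cval x - 1)).
  by apply/normc_continuous/ccontB; [exact: ccont_cval|exact: ccont_cst].
have := circle_measurable cu measurableT (@measurable_itv R `[e, +oo[).
rewrite setTI; congr measurable; apply/seteqP; split => x /=;
  by rewrite in_itv/= andbT -[`|_|]/((normc _)%:C) lecR.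
Qed.

(** On the circle [|zeta - 1| <= e + 2 * \1_A], whose integral is at most [3 * e]; the componentwise
    estimate doubles it. *)
Lemma mean_near1 mu (e : R) : 0 <= e ->
  (mu [set x | e%:C <= `|cval x - 1|]%R <= e%:E)%E -> 1 - 6 * e <= normc (mean mu).
Proof.
move=> e0; set A := [set x | _] => muA.
have mA : measurable A := measurable_far_from1 e.
have cc : ccont (fun x : circle R => cval x - 1).
  by apply: ccontB; [exact: ccont_cval|exact: ccont_cst].
have cn := normc_continuous cc.
have iA : mu.-integrable setT (EFin \o (fun x => 2 * \1_A x)).
  have := integrableZl measurableT 2 (integrable_indic mu mA).
  by under eq_fun do rewrite -EFinM.
have H : \int[mu]_x normc (cval x - 1) <= e + 2 * e.
  apply: (@le_trans _ _ (\int[mu]_x (e + 2 * \1_A x))).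
    apply: le_Rintegral => //; first exact: circle_integrable.
      have := integrableD measurableT (circle_integrable mu (@rcont_cst R e)) iA.
      by [].
    move=> x _; have [xA|xA] := boolP (x \in A); rewrite indicE ?xA ?(negbTE xA).
      rewrite mulr1 (le_trans (normcB _ _))// normc_cval normc1; lra.
    rewrite mulr0 addr0; apply/ltW; rewrite ltNge; apply: contraNN xA => xA.
    by rewrite inE /A/= -[`|_|]/((normc _)%:C) lecR.
  rewrite RintegralD//; last exact/circle_integrable/rcont_cst.
  rewrite RintegralZl//; last exact: integrable_indic.
  rewrite Rintegral_cst// [X in fine X](_ : _ = 1%E) ?mulr1; last exact: probability_setT.
  rewrite lerD2l ler_wpM2l// /Rintegral integral_indic// setIT.
  by rewrite -lee_fin fineK// fin_num_measure.
have : normc (mean mu - 1) <= 2 * \int[mu]_x normc (cval x - 1).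
  have -> : mean mu - 1 = cintegral mu (fun x => cval x - 1).
    rewrite cintegralB ?cintegral_cst//; [exact: ccont_cval|exact: ccont_cst].
  exact: normc_cintegral.
have := normcB_ge 1 (mean mu); rewrite normc1 normc_distC; lra.
Qed.

Lemma infinitesimal_mean (k : nat -> nat) (mu : forall n, 'I_(k n) -> PT) :
  infinitesimal mu -> \forall n \near \oo, forall i, 1/2 <= normc (mean (mu n i)).
Proof.
(* [1 - 6 * e = 1/2] for this [e]. *)
have e0 : 0 < 1/12 :> R by lra.
move=> /(_ _ e0) /(_ [set x | (x < (1/12)%:E)%E]) [].
  by apply: open_nbhs_nbhs; split; [exact: open_ereal_lt_ereal|rewrite /= lte_fin].
move=> N _ HN; exists N => // n Nn i.
have : (mu n i [set x | (1/12)%:C <= `|cval x - 1|]%R <= (1/12)%:E)%E.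
  apply: le_trans (ltW (HN n Nn)).
  exact: (le_bigmax _ (fun i => mu n i [set x | (1/12)%:C <= `|cval x - 1|]) i).
by move=> /(mean_near1 (ltW e0)); lra.
Qed.

Lemma iter_op_prod (T I : Type) (op : T -> T -> T -> Prop)
    (P : T -> {poly C} -> Prop) (F : I -> T) (t : I -> {poly C}) s :
  (forall x y z p q, op x y z -> P x p -> P y q -> P z (p * q)) ->
  (forall i, P (F i) (t i)) ->
  forall x t0 z, P x t0 -> iter_op op x [seq F i | i <- s] z ->
  P z (t0 * \prod_(i <- s) t i).
Proof.
move=> opP Pt; elim: s => [|i s ih] x t0 z Px /=.
  by move=> ->; rewrite big_nil mulr1.
move=> [w xw wz]; rewrite big_cons mulrA; apply: ih wz.
exact: opP xw Px (Pt i).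
Qed.

Section criterion.
Variables (k : nat -> nat) (lambda : nat -> circle R).
Variables (mu : forall n, 'I_(k n) -> PT) (X : nat -> PT).
Arguments mu : clear implicits.

Hypothesis mu_half : \forall n \near \oo, forall i, 1/2 <= normc (mean (mu n i)).
(** The common form of both convolutions: [Phi] and [t] vary with [n], while [K] and [B] do not. The
    order [N.+1] is at least 1, so that [psi_poly] retains its linear coefficient, the mean. *)
Hypothesis X_exp : forall N, exists K B : R, [/\ 1 <= K, 0 <= B &
  \forall n \near \oo, exists Phi (t : 'I_(k n) -> {poly C}),
    [/\ Phi`_0 = 0, nrm 1 N.+1 Phi <= K,
      forall i, (t i)`_0 = mean (mu n i) /\
        nrm 1 N.+1 (t i - ((t i)`_0)%:P) <= B * (1 - normc (t i)`_0) &
      texp N.+1 (Btransf (X n))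
        (((cval (lambda n))%:P * \prod_(i <- enum 'I_(k n)) t i) \Po Phi)]].

Let S n : R := \prod_(i <- enum 'I_(k n)) normc (mean (mu n i)).

Lemma normc_mean_product : \forall n \near \oo, normc (mean (X n)) = S n.
Proof.
have [K [B [_ _]]] := X_exp 0; apply: filterS => n [Phi [t [Phi0 _ tE Bt]]].
rewrite (mean_texp Phi0 Bt) coefCM normcM normc_cval mul1r -horner_coef0.
rewrite horner_prod normc_prod; apply: eq_bigr => i _.
by rewrite horner_coef0 (tE i).1.
Qed.

Lemma moment_le_product j : exists Q, \forall n \near \oo,
  normc (moment (X n) j.+1) ^+ 3 <= Q * S n.
Proof.
have [K [B [K1 B0 HX]]] := X_exp j.
have [Q Q0 HQ] := nrm_prod_decay j.+1 B0.
pose c := K ^+ j.+1 * (j.+2%:R * 2).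
have c0 : 0 <= c by rewrite mulr_ge0// exprn_ge0// (le_trans ler01).
exists (c ^+ 3 * Q); near=> n.
have half : forall i, 1/2 <= normc (mean (mu n i)) by near: n; exact: mu_half.
have [Phi [t [Phi0 PhiK tE Bt]]] : exists Phi (t : 'I_(k n) -> {poly C}),
    [/\ Phi`_0 = 0, nrm 1 j.+1 Phi <= K,
      forall i, (t i)`_0 = mean (mu n i) /\
        nrm 1 j.+1 (t i - ((t i)`_0)%:P) <= B * (1 - normc (t i)`_0) &
      texp j.+1 (Btransf (X n))
        (((cval (lambda n))%:P * \prod_(i <- enum 'I_(k n)) t i) \Po Phi)].
  by near: n; exact: HX.
have := moment_le_nrm K1 Phi0 PhiK Bt (leqnSn j).
set P := \prod_(i <- _) _ => H.
have HP : nrm 1 j.+1 ((cval (lambda n))%:P * P) <= nrm 1 j.+1 P.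
  apply: (le_trans (nrmM _ _ _ ler01)).
  by rewrite nrmC normc_cval mul1r.
have {}H : normc (moment (X n) j.+1) <= nrm 1 j.+1 P * c.
  by rewrite (le_trans H)// ler_wpM2r.
apply: (@le_trans _ _ ((nrm 1 j.+1 P * c) ^+ 3)).
  by rewrite lerXn2r ?nnegrE ?normc_ge0// mulr_ge0 ?nrm_ge0.
rewrite exprMn mulrC -mulrA ler_wpM2l ?exprn_ge0//.
rewrite /S; under [X in _ * X]eq_bigr => i _ do rewrite -(tE i).1.
apply: HQ => i; last exact: (tE i).2.
by rewrite (tE i).1 half normc_mean_le1.
Unshelve. all: by end_near. Qed.

(** [S n] is eventually the modulus of the mean of [X n], which weak convergence sends to 0;
    conversely it dominates the cube of every moment up to a constant. *)
Lemma haar_criterion : weak_cvg X (haar R) <-> S @ \oo --> 0.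
Proof.
split.
  move=> /weak_cvg_mean H; apply: cvg_trans H; apply: near_eq_cvg.
  exact: normc_mean_product.
move=> S0; apply: weak_cvg_haar => j; have [Q HQ] := moment_le_product j.
apply/cvgrPdist_lt => e e0.
have QS : (fun n => Q * S n) @ \oo --> 0.
  exact: cvgZ0.
have e3 : 0 < e ^+ 3 by rewrite exprn_gt0.
move/cvgrPdist_lt : QS => /(_ _ e3) QS.
near=> n; rewrite sub0r normrN ger0_norm ?normc_ge0//.
rewrite -(@ltr_pXn2r _ 3)// ?nnegrE ?normc_ge0 ?(ltW e0)//.
apply: (@le_lt_trans _ _ (Q * S n)); first by near: n.
apply: (le_lt_trans (ler_norm _)); rewrite -normrN -sub0r.
by near: n.
Unshelve. all: by end_near. Qed.

End criterion.
End main.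

Theorem theorem5p7 (R : realType) (k : nat -> nat)
    (lambda lambda' : nat -> circle R)
    (mu nu : forall n : nat, 'I_(k n) -> probability (circle R) R)
    (mu_ nu_ rho_ : nat -> probability (circle R) R)
    (nu_lim : probability (circle R) R)
    (k_gt0 : forall n, (0 < k n)%N)
    (mu_nz : forall n i, nonzero_mean (mu n i))
    (nu_nz : forall n i, nonzero_mean (nu n i))
    (mu_inf : infinitesimal mu)
    (nu_inf : infinitesimal nu)
    (mu_nu_def : forall n, iter_op (@cfree_conv R)
      (point_mass (lambda n), point_mass (lambda' n))
      [seq (mu n i, nu n i) | i <- enum 'I_(k n)] (mu_ n, nu_ n))
    (rho_def : forall n, iter_op (@bool_conv R)
      (point_mass (lambda n)) [seq mu n i | i <- enum 'I_(k n)] (rho_ n))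
    (nu_cvg : weak_cvg nu_ nu_lim) :
  weak_cvg mu_ (haar R) <-> weak_cvg rho_ (haar R).
Proof.
have mu_half := infinitesimal_mean mu_inf.
have nu_half := infinitesimal_mean nu_inf.
(* Both sides of the equivalence become the same statement, since [S] depends on the array [mu]
   only. *)
rewrite (haar_criterion (lambda := lambda) (X := mu_) mu_half); last first.
  move=> N; pose K : R := N.+2%:R * 2.
  have K1 : 1 <= K by rewrite /K -natrM ler1n.
  have [B B0 HB] := exists_T_poly N.+1 K1.
  exists K, B; split=> //; apply: filterS nu_half => n half.
  have psi1 i : 1/2 <= normc (psi_poly N.+1 (nu n i))`_1 by rewrite coef_poly half.
  have /choice[t Ht] i := HB (mu n i) (psi_poly N.+1 (nu n i))
    (psi_poly_coef0 _ _) (psi1 i) (nrm_psi_poly _ _).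
  (* The [t i] were obtained by inverting the [psi] of [nu n i]; the product is composed with the
     [psi] of [nu_ n], about which only the norm bound is asked. *)
  exists (psi_poly N.+1 (nu_ n)), t; split.
  - exact: psi_poly_coef0.
  - exact: nrm_psi_poly.
  - by move=> i; have [] := Ht i.
  apply: (@iter_op_prod R _ _ (@cfree_conv R)
    (fun p t => texp N.+1 (Btransf p.1) (t \Po psi_poly N.+1 p.2))
    (fun i => (mu n i, nu n i)) t _ _ _ _ _ _ _ (mu_nu_def n)).
  - by move=> x y z p q; exact: cfree_conv_texp.
  - by move=> i; have [] := Ht i.
  - by rewrite comp_polyC; exact: texp_Btransf_point_mass.
rewrite (haar_criterion (lambda := lambda) (X := rho_) mu_half)// => N.
have [B B0 HB] := exists_T_poly N.+1 (lexx (1 : R)).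
have nX : nrm 1 N.+1 ('X : {poly R[i]}) <= 1.
  by have := nrmZXn N.+1 (1 : R[i]) 1; rewrite scale1r normc1.
have X0 : ('X : {poly R[i]})`_0 = 0 by rewrite coefX.
have X1 : 1/2 <= normc ('X : {poly R[i]})`_1 by rewrite coefX normc1; lra.
exists 1, B; split=> //; near=> n.
have /choice[t Ht] i := HB (mu n i) 'X X0 X1 nX.
exists 'X, t; split=> //.
  by move=> i; have [] := Ht i.
rewrite comp_polyXr.
apply: (@iter_op_prod R _ _ (@bool_conv R) (fun m t => texp N.+1 (Btransf m) t)
  (fun i => mu n i) t _ _ _ _ _ _ _ (rho_def n)).
- by move=> x y z p q; exact: bool_conv_texp.
- by move=> i; have [_ _] := Ht i; rewrite comp_polyXr.
- exact: texp_Btransf_point_mass.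
Unshelve. all: by end_near. Qed.
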